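(* Let $A=\mathbb{R}/\mathbb{Z}\times[0,1]$ and let $f:A\to A$ be a $C^1$ diffeomorphism mapping each boundary component of $A$ to itself. If $f$ is an area preserving twist map, then $f$ has at least two fixed points in $A$.
   Context: $A=\mathbb{R}/\mathbb{Z}\times[0,1]$ is the standard annulus, with $x$ the $1$-periodic coordinate and $y$ the radial coordinate; its universal cover is $\widetilde A=\mathbb{R}\times[0,1]$. Its boundary components are $\mathbb{R}/\mathbb{Z}\times\{0\}$ and $\mathbb{R}/\mathbb{Z}\times\{1\}$. Twist map: $f$ is called a twist map if it has a lift $\widetilde f=(\tilde f_1,\tilde f_2):\widetilde A\to\widetilde A$ to the universal cover such that $\tilde f_1(x,0)<x$ and $\tilde f_1(x,1)>x$ for all $x\in\mathbb{R}$. Area preserving means that $f$ preserves the Lebesgue measure $dx\,dy$ on $A$. *)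

(* Defs.v *)
From HB Require Import structures.
From mathcomp Require Import all_boot all_order all_algebra.
From mathcomp Require Import generic_quotient ring_quotient.
From mathcomp Require Import all_classical all_reals all_analysis.

Set Implicit Arguments.
Unset Strict Implicit.
Unset Printing Implicit Defensive.

Import Order.TTheory GRing.Theory Num.Theory.
Import numFieldNormedType.Exports.

Local Open Scope classical_set_scope.
Local Open Scope quotient_scope.
Local Open Scope ring_scope.

Section annulus.
Variable R : realType.

(* [Num.int_num_subdef] is the predicate behind [x \is a Num.int], so [circle] is
   the quotient group R/Z. *)
Definition circle :=
  Quotient.quot (GRing.ZmodClosed.clone R (@Num.int_num_subdef R) _).

Definition annulus : set (circle * R) := [set p | 0 <= p.2 <= 1].

Definition boundary_circle (c : R) : set (circle * R) := [set p | p.2 = c].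

Definition universal_cover : set (R * R) := [set z | 0 <= z.2 <= 1].

Definition covering_map (z : R * R) : circle * R := (\pi_circle z.1, z.2).

Definition lift_of (f : circle * R -> circle * R) (F : R * R -> R * R) : Prop :=
  [/\ set_fun universal_cover universal_cover F, {within universal_cover, continuous F} &
      {in universal_cover, forall z, covering_map (F z) = f (covering_map z)}].

Definition C1_on (U : set (R * R)) (G : R * R -> R * R) : Prop :=
  {in U, forall z, differentiable G z} /\
  forall v : R * R, {in U, forall z, {for z, continuous ('D_v G)}}.

(* The charts of the annulus are the local inverses of [covering_map], so [f] is
   C^1 when, near each point, it is represented in the coordinates (x, y) by a
   C^1 map. At boundary points this means, as usual for manifolds with boundary,
   that the representative extends to a C^1 map on an open set of the plane. *)
Definition C1_annulus_map (f : circle * R -> circle * R) : Prop :=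
  set_fun annulus annulus f /\
  {in universal_cover, forall z, exists (U : set (R * R)) (G : R * R -> R * R),
    [/\ open U, U z, C1_on U G &
        {in U `&` universal_cover, forall w, covering_map (G w) = f (covering_map w)}]}.

Definition C1_annulus_diffeo (f : circle * R -> circle * R) : Prop :=
  C1_annulus_map f /\
  exists g, [/\ C1_annulus_map g, {in annulus, cancel f g} &
                {in annulus, cancel g f}].

Definition twist_map (f : circle * R -> circle * R) : Prop :=
  exists F, [/\ lift_of f F, forall x : R, (F (x, 0)).1 < x &
                             forall x : R, x < (F (x, 1)).1].

(* The Borel subsets of the annulus are those with Borel preimage in the cover;
   their area is computed on the fundamental domain [0, 1[ * [0, 1]. *)
Definition annulus_measurable (B : set (circle * R)) : Prop :=
  B `<=` annulus /\
  measurable (covering_map @^-1` B : set (measurableTypeR R * measurableTypeR R)).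

Definition area (B : set (circle * R)) : \bar R :=
  (@lebesgue_measure R \x @lebesgue_measure R)%E
    ((`[0, 1[ `*` `[0, 1]) `&` covering_map @^-1` B).

Definition area_preserving (f : circle * R -> circle * R) : Prop :=
  forall B, annulus_measurable B ->
    annulus_measurable (annulus `&` f @^-1` B) /\
    area (annulus `&` f @^-1` B) = area B.

End annulus.

(* Main.v *)
Require Import Defs.
From HB Require Import structures.
From mathcomp Require Import all_boot all_order all_algebra.
From mathcomp Require Import all_classical all_reals all_analysis.
From mathcomp Require Import ring lra.
Import Order.TTheory GRing.Theory Num.Theory.
Import numFieldNormedType.Exports.
Set Implicit Arguments.
Unset Strict Implicit.
Unset Printing Implicit Defensive.
Local Open Scope classical_set_scope.
Local Open Scope ring_scope.

(** The proof follows Birkhoff in the form given by Brown and Neumann. If the map had at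
    most one fixed point, the fixed points of its lift [h] to the strip would form at most
    one orbit of the integer translations. Extend [h] to the plane, by its action on the
    boundary lines, and consider the displacement [h z - z]. It points to the left below
    the strip and to the right above it, and this forces the index of the fixed point to
    be zero: the displacement has an angle that is continuous on the whole plane apart
    from the fixed points ([global_angle]), with a constant value [a] below the strip and
    a constant value [b] above it.

    Compose [h] with a small vertical shear that pushes points upwards and is trivial near
    the vertical lines through the fixed points. If no orbit of the sheared map climbed
    from below the annulus to above it, the region swept from below would remain in the
    annulus while having to absorb a positive area at each step ([escape_exists]). Join the
    first two points of a climbing orbit by a suitable arc; its successive images form an
    arc [C] with [C (t + 1)] the image of [C t], and this arc is simple ([arc_simple]). The
    chord [C t - C s] therefore never vanishes for [s < t]. For parameters that differ by 1
    it is the displacement of the sheared map, and deforming these chords into the chords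
    from the start and to the end of the arc shows that the displacement turns clockwise
    from below to above: [b < a] ([angle_drop]).

    The inverse of [h], reflected in a vertical axis, satisfies the same hypotheses. The
    displacement of the inverse at [h z] is opposite to that of [h] at [z], so after the
    reflection its angles are [- a] and [- b], and the same argument gives [- b < - a], a
    contradiction ([no_double_escape]). *)

(** * Continuity and compactness *)

Section continuity.
Variable R : realType.

Lemma cont_pair (T : topologicalType) (f g : T -> R) x :
  {for x, continuous f} -> {for x, continuous g} ->
  {for x, continuous (fun t => (f t, g t))}.
Proof. by move=> cf cg; exact: (@cvg_pair _ _ _ (nbhs x) (nbhs (f x)) (nbhs (g x))). Qed.

Lemma cont_fst (T : topologicalType) (f : T -> R * R) x :
  {for x, continuous f} -> {for x, continuous (fun t => (f t).1)}.
Proof. by move=> cf; apply: (continuous_comp cf); exact: cvg_fst. Qed.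

Lemma cont_snd (T : topologicalType) (f : T -> R * R) x :
  {for x, continuous f} -> {for x, continuous (fun t => (f t).2)}.
Proof. by move=> cf; apply: (continuous_comp cf); exact: cvg_snd. Qed.

Lemma cont_id (T : topologicalType) (x : T) : {for x, continuous (fun t : T => t)}.
Proof. exact: cvg_id. Qed.

Lemma cont_within (T U : topologicalType) (f : T -> U) (A : set T) :
  (forall x, A x -> {for x, continuous f}) -> {within A, continuous f}.
Proof.
move=> cf; apply: continuous_in_subspaceT => x /set_mem Ax; exact: cf.
Qed.

Lemma cont_max (T : topologicalType) (f g : T -> R) x :
  {for x, continuous f} -> {for x, continuous g} ->
  {for x, continuous (fun t => Num.max (f t) (g t))}.
Proof. by move=> cf cg; apply: continuous_max. Qed.

Lemma cont_min (T : topologicalType) (f g : T -> R) x :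
  {for x, continuous f} -> {for x, continuous g} ->
  {for x, continuous (fun t => Num.min (f t) (g t))}.
Proof. by move=> cf cg; apply: continuous_min. Qed.

(** All uniform estimates below come from this bound: applied to a maximum of two
    functions, it makes one of them large wherever the other is small. *)
Lemma compact_pos_lbound (T : topologicalType) (K : set T) (g : T -> R) :
  compact K -> continuous g -> (forall z, K z -> 0 < g z) ->
  exists2 m, 0 < m & forall z, K z -> m <= g z.
Proof.
move=> cK cg pg; have [K0|/set0P[z0 Kz0]] := eqVneq K set0.
  by exists 1 => // z; rewrite K0.
have [|c /set_mem Kc cmin] := @compact_EVT_min _ R g K _ cK (continuous_subspaceT cg).
  by exists z0.
by exists (g c); [exact: pg|move=> z Kz; apply: cmin; exact/mem_set].
Qed.

End continuity.

(** * Angles of plane vectors *)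

Section angle.
Variable R : realType.
Implicit Types (u v w z c : R * R) (a b t : R).

(** Stated as a relation and not through an argument function, because continuous
    choices of the angle must leave every interval of length [2 pi]. *)
Definition has_angle v t := exists2 r : R, 0 < r & v = (r * cos t, r * sin t).

Definition dot v w := v.1 * w.1 + v.2 * w.2.
Definition cross v w := v.1 * w.2 - v.2 * w.1.

(** Two angles of one vector differ by a multiple of [2 pi]. The cosine of the
    difference expresses this without an integer, which is the form in which
    continuity arguments use it. *)
Lemma has_angle_cosB v a b : has_angle v a -> has_angle v b -> cos (a - b) = 1.
Proof.
move=> [r r0 ->] [s s0 [e1 e2]].
have ca := cos2Dsin2 a; have cb := cos2Dsin2 b.
have rs : r = s.
  apply/eqP; rewrite -(@eqrXn2 _ 2) ?ltW//; apply/eqP.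
  have -> : r ^+ 2 = (r * cos a) ^+ 2 + (r * sin a) ^+ 2.
    by rewrite !exprMn -mulrDr ca mulr1.
  by rewrite e1 e2 !exprMn -mulrDr cb mulr1.
have r0' : r != 0 by rewrite gt_eqF.
move: e1 e2; rewrite -rs => /(mulfI r0') e1 /(mulfI r0') e2.
by rewrite cosB e1 e2 -!expr2.
Qed.

(** Vectors with opposite angles are opposite up to a positive factor; excluding this
    confines the difference of their angles to one interval of length [2 pi]. *)
Lemma has_angle_cosN1 v w a b : has_angle v a -> has_angle w b ->
  cos (b - a) = -1 -> exists2 l, 0 < l & w = (- l * v.1, - l * v.2).
Proof.
move=> [r r0 ->] [s s0 ->] cab.
have sab : sin (b - a) = 0 by apply: cos1sin0; rewrite cab normrN normr1.
exists (s / r); first exact: divr_gt0.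
have r0' : r != 0 by rewrite gt_eqF.
have -> : b = a + (b - a) by lra.
by rewrite (cosD a) (sinD a) sab cab /=; congr (_, _); field.
Qed.

(** The vector [w] lies less than a right angle away from [v], so that the angle
    between them is the arctangent of the ratio of cross and dot products; this depends
    continuously on both vectors. *)
Lemma has_angle_dot v w a : has_angle v a -> 0 < dot v w ->
  has_angle w (a + atan (cross v w / dot v w)).
Proof.
move=> [r r0 ->]; rewrite /dot /cross /=; case: w => p q /=.
set A := r * cos a * p + r * sin a * q; set B := r * cos a * q - r * sin a * p => A0.
set x := B / A; set s := Num.sqrt (1 + x ^+ 2).
have s0 : 0 < s by rewrite sqrtr_gt0; apply: ltr_pwDl => //; exact: sqr_ge0.
have cx : cos (atan x) = s^-1 by rewrite cos_atan.
have sx : sin (atan x) = x / s.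
  by rewrite -cx -[X in X * _](atanK x) /tan mulfVK// cx invr_eq0 gt_eqF.
have r0' : r != 0 by rewrite gt_eqF.
have s0' : s != 0 by rewrite gt_eqF.
have A0' : A != 0 by rewrite gt_eqF.
exists (A * s / r); first by rewrite divr_gt0// mulr_gt0.
have ca := cos2Dsin2 a.
have sa : sin a ^+ 2 = 1 - cos a ^+ 2 by rewrite -ca; ring.
rewrite cosD sinD cx sx; congr (_, _).
- transitivity (p * (cos a ^+ 2 + sin a ^+ 2)); first by rewrite ca mulr1.
  transitivity ((cos a * A - sin a * B) / r); first by rewrite /A /B; field.
  by rewrite /x; field; rewrite s0' A0' r0'.
- transitivity (q * (cos a ^+ 2 + sin a ^+ 2)); first by rewrite ca mulr1.
  transitivity ((sin a * A + cos a * B) / r); first by rewrite /A /B; field.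
  by rewrite /x; field; rewrite s0' A0' r0'.
Qed.

Lemma has_angle_upper v : 0 < v.2 -> exists2 t, 0 < t < pi & has_angle v t.
Proof.
case: v => p q /= q0; set r := Num.sqrt (p ^+ 2 + q ^+ 2).
have q20 : 0 < q ^+ 2 by rewrite exprn_gt0.
have r20 : 0 < p ^+ 2 + q ^+ 2 by rewrite ltr_wpDl// sqr_ge0.
have r0 : 0 < r by rewrite sqrtr_gt0.
have r2 : r ^+ 2 = p ^+ 2 + q ^+ 2 by rewrite sqr_sqrtr// ltW.
have pr : -1 < p / r < 1.
  rewrite -ltr_norml normrM normfV (gtr0_norm r0) ltr_pdivrMr// mul1r.
  rewrite -(@ltr_pXn2r _ 2) ?nnegrE ?normr_ge0 ?(ltW r0)//.
  by rewrite [ltRHS]r2 real_normK ?num_real// ltrDl.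
have pr' : -1 <= p / r <= 1 by lra.
exists (acos (p / r)); first by rewrite acos_gt0 ?acos_ltpi//; lra.
exists r => //; rewrite acosK ?in_itv//= sin_acos//.
have r0' : r != 0 by rewrite gt_eqF.
rewrite mulrCA divff// mulr1; congr pair.
have -> : 1 - (p / r) ^+ 2 = (q / r) ^+ 2.
  have -> : (q / r) ^+ 2 = (r ^+ 2 - p ^+ 2) / r ^+ 2.
    by rewrite [in X in (X - _) / _]r2; field.
  by field.
by rewrite sqrtr_sqr ger0_norm ?divr_ge0 ?ltW// mulrCA divff// mulr1.
Qed.

Lemma has_angle_cos v t : has_angle v t -> (0 < cos t) = (0 < v.1).
Proof. by move=> [r r0 ->] /=; rewrite pmulr_rgt0. Qed.

Lemma has_angle_cosN v t : has_angle v t -> (cos t < 0) = (v.1 < 0).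
Proof. by move=> [r r0 ->] /=; rewrite pmulr_rlt0. Qed.

Lemma has_angle_sin v t : has_angle v t -> (0 < sin t) = (0 < v.2).
Proof. by move=> [r r0 ->] /=; rewrite pmulr_rgt0. Qed.

(** By the intermediate value theorem, [u] could only leave the interval through an
    odd multiple of [pi]. *)
Lemma cos_stay (u : R -> R) a b : a <= b -> {within `[a, b], continuous u} ->
  (forall t, a <= t <= b -> cos (u t) <> -1) -> - pi < u a < pi -> - pi < u b < pi.
Proof.
move=> ab cu cN /andP[ua1 ua2]; apply/andP; split; rewrite ltNge; apply/negP => ub.
  have [|t] := @IVT _ u a b (- pi) ab cu.
    by rewrite ge_min le_max ub (ltW ua1) orbT.
  by rewrite in_itv/= => /cN + ut; rewrite ut cosN cospi.
have [|t] := @IVT _ u a b pi ab cu.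
  by rewrite ge_min le_max ub (ltW ua2) orbT.
by rewrite in_itv/= => /cN + ut; rewrite ut cospi.
Qed.

Lemma cos_eq1_small a : - pi < a < pi -> cos a = 1 -> a = 0.
Proof.
move=> /andP[a1 a2] ca; apply/eqP; rewrite -normr_eq0; apply/eqP.
have pi0 := pi_ge0 R.
apply: cos_inj; rewrite ?in_itv/= ?lexx ?normr_ge0 ?pi0//.
  by rewrite ler_norml !ltW.
by rewrite cos_norm cos0.
Qed.

(** A continuous function with values in the multiples of [2 pi] is constant. It gives
    both the uniqueness of angle lifts and the constancy of integer-valued functions. *)
Lemma cos_eq1_const (u : R -> R) a b : a <= b -> {within `[a, b], continuous u} ->
  (forall t, a <= t <= b -> cos (u t) = 1) -> u a = 0 -> u b = 0.
Proof.
move=> ab cu c1 ua; have pi0 := pi_gt0 R.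
apply: cos_eq1_small; last by apply: c1; lra.
apply: (cos_stay ab cu); last by rewrite ua; lra.
by move=> t /c1 -> h; lra.
Qed.

Lemma cos_gt0_small a : - pi < a < pi -> 0 < cos a -> - (pi / 2) < a < pi / 2.
Proof.
move=> ha ca; rewrite -ltr_norml ltNge; apply/negP => h.
have pi0 := pi_gt0 R; move: ha; rewrite -ltr_norml => ha.
move: ca; rewrite -cos_norm ltNge => /negP; apply.
rewrite -(@cos_pihalf R); have [->//|ne] := eqVneq (pi / 2) `|a|.
apply: ltW; rewrite ltr_cos ?lt_neqAle ?ne ?h// in_itv/= ?normr_ge0 ?ltW//; lra.
Qed.

Lemma cos_gtN1 (x : R) : - pi < x < pi -> cos x <> -1.
Proof.
rewrite -ltr_norml -cos_norm -(cospi R) => xp cx.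
have pi0 := pi_ge0 R; suff e : `|x| = pi by rewrite e ltxx in xp.
by apply: cos_inj; rewrite ?in_itv/= ?normr_ge0 ?pi0 ?lexx ?(ltW xp).
Qed.

End angle.

(** * Lifting the angle over star-shaped sets *)

Section lift.
Variable R : realType.
Implicit Types (w : R * R -> R * R) (z c : R * R) (K E : set (R * R)).

Lemma cont_dot (T : topologicalType) (f g : T -> R * R) x :
  {for x, continuous f} -> {for x, continuous g} ->
  {for x, continuous (fun t => dot (f t) (g t))}.
Proof.
move=> cf cg; apply: continuousD; apply: continuousM.
- exact: cont_fst.
- exact: cont_fst.
- exact: cont_snd.
- exact: cont_snd.
Qed.

Lemma cont_cross (T : topologicalType) (f g : T -> R * R) x :
  {for x, continuous f} -> {for x, continuous g} ->
  {for x, continuous (fun t => cross (f t) (g t))}.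
Proof.
move=> cf cg; apply: continuousB; apply: continuousM.
- exact: cont_fst.
- exact: cont_snd.
- exact: cont_snd.
- exact: cont_fst.
Qed.

Lemma cont_sum (T : topologicalType) (F : nat -> T -> R) x n :
  (forall i, (i < n)%N -> {for x, continuous (F i)}) ->
  {for x, continuous (fun t => \sum_(i < n) F i t)}.
Proof.
elim: n => [_|n IH cF].
  have -> : (fun t => \sum_(i < 0) F i t) = cst 0.
    by apply/funext => t; rewrite big_ord0.
  exact: cst_continuous.
have -> : (fun t => \sum_(i < n.+1) F i t) = (fun t => \sum_(i < n) F i t + F n t).
  by apply/funext => t; rewrite big_ord_recr.
apply: continuousD; last exact: cF.
by apply: IH => i iN; apply: cF; exact: ltnW.
Qed.

Definition seg c z (t : R) := (c.1 + t * (z.1 - c.1), c.2 + t * (z.2 - c.2)).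

Lemma cont_seg (T : topologicalType) c (f : T -> R * R) (g : T -> R) x :
  {for x, continuous f} -> {for x, continuous g} ->
  {for x, continuous (fun t => seg c (f t) (g t))}.
Proof.
move=> cf cg; apply: cont_pair; apply: continuousD; try exact: cst_continuous;
  apply: continuousM => //; apply: continuousB; try exact: cst_continuous.
- exact: cont_fst.
- exact: cont_snd.
Qed.

Lemma seg0 c z : seg c z 0 = c.
Proof. by case: c => a b; rewrite /seg !mul0r !addr0. Qed.

Lemma seg1 c z : seg c z 1 = z.
Proof. by case: z => a b; rewrite /seg !mul1r /= !(addrC _ (_ - _)) !subrK. Qed.

Lemma segcc c t : seg c c t = c.
Proof. by case: c => a b; rewrite /seg !subrr !mulr0 !addr0. Qed.

Lemma seg_seg c z s t : seg c (seg c z s) t = seg c z (t * s).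
Proof. by rewrite /seg /=; congr (_, _); ring. Qed.

Definition star_at c K := forall z t, K z -> 0 <= t <= 1 -> K (seg c z t).

(** On a compact set, uniform continuity cuts every segment issued from the center
    into the same number [N] of pieces along which the vector turns by less than a right
    angle. Adding up these small angles gives an explicit continuous formula. *)
Lemma compact_lift w c K tc : continuous w -> compact K -> star_at c K ->
  (forall z, K z -> 0 < dot (w z) (w z)) -> has_angle (w c) tc ->
  exists th : R * R -> R, [/\ th c = tc, forall z, K z -> {for z, continuous th} &
    forall z, K z -> has_angle (w z) (th z)].
Proof.
move=> cw cK sK wK wc.
(* At parameters closer than the lower bound of [g], the dot product is positive. *)
pose g (p : (R * R) * (R * R)) :=
  Num.max (dot (w (seg c p.1 p.2.1)) (w (seg c p.1 p.2.2))) `|p.2.1 - p.2.2|.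
have cg : continuous g.
  move=> p.
  have c1 : {for p, continuous (fun p : (R * R) * (R * R) => p.1)} by exact: cvg_fst.
  have c21 : {for p, continuous (fun p : (R * R) * (R * R) => p.2.1)}.
    by apply: cont_fst; exact: cvg_snd.
  have c22 : {for p, continuous (fun p : (R * R) * (R * R) => p.2.2)}.
    by apply: cont_snd; exact: cvg_snd.
  suff : {for p, continuous g} by [].
  apply: cont_max.
    apply: cont_dot.
      apply: (@continuous_comp _ _ _ (fun p : (R * R) * (R * R) => seg c p.1 p.2.1) w);
        last exact: cw.
      by apply: cont_seg; [exact: c1|exact: c21].
    apply: (@continuous_comp _ _ _ (fun p : (R * R) * (R * R) => seg c p.1 p.2.2) w);
      last exact: cw.
    by apply: cont_seg; [exact: c1|exact: c22].
  apply: (@continuous_comp _ _ _ (fun p : (R * R) * (R * R) => p.2.1 - p.2.2) (fun x : R => `|x|)).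
    exact: continuousB.
  exact: norm_continuous.
have [|p|m m0 mP] := @compact_pos_lbound R _ (K `*`
  ([set` `[0, 1 : R]] `*` [set` `[0, 1 : R]])) g _ cg.
- by do 2?[apply: compact_setX => //]; exact: segment_compact.
- case: p => z [s t] [/= Kz]; rewrite !in_itv/= => -[s01 t01].
  rewrite /g lt_max /=; have [<-|st] := eqVneq s t.
    by rewrite wK//; exact: sK.
  by rewrite orbC normr_gt0 subr_eq0 st.
pose N := (Num.bound m^-1).+1.
have Nm : N%:R^-1 < m :> R.
  rewrite invf_plt ?posrE// (lt_trans (archi_boundP _)) ?invr_ge0 ?ltW//.
  by rewrite ltr_nat.
pose p z i := w (seg c z (i%:R / N%:R)).
have N0 : (0 : R) < N%:R by rewrite ltr0n.
have frac i : (i <= N)%N -> 0 <= (i%:R / N%:R : R) <= 1.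
  move=> iN; apply/andP; split; first exact: divr_ge0.
  by rewrite ler_pdivrMr// mul1r ler_nat.
have pd z i : K z -> (i < N)%N -> 0 < dot (p z i) (p z i.+1).
  move=> Kz iN; have /(_ (z, (i%:R / N%:R, i.+1%:R / N%:R))) := mP.
  rewrite /g /= le_max => h.
  have {}h := h (conj Kz (conj _ _)); move: h;
    rewrite !in_itv/= !frac ?(ltnW iN)// => /(_ isT isT) /orP[].
    exact: lt_le_trans.
  rewrite leNgt distrC -mulrBl -[i.+1]addn1 natrD addrAC subrr add0r mul1r.
  by rewrite ger0_norm ?invr_ge0 ?(ltW N0)// Nm.
pose th z := tc + \sum_(i < N) atan (cross (p z i) (p z i.+1) / dot (p z i) (p z i.+1)).
exists th; split.
- rewrite /th big1 ?addr0// => i _; rewrite /p.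
  rewrite !segcc /cross [X in X - _]mulrC subrr mul0r atan0 //.
- move=> z Kz; apply: continuousD; first exact: cst_continuous.
  apply: (@cont_sum _ (fun i z => atan (cross (p z i) (p z i.+1) / dot (p z i)
    (p z i.+1)))) => i iN /=.
  have cp j : {for z, continuous (fun z => p z j)}.
    apply: (@continuous_comp _ _ _ (fun z => seg c z (j%:R / N%:R)) w); last exact: cw.
    by apply: cont_seg; [exact: cont_id|exact: cst_continuous].
  apply: (@continuous_comp _ _ _ (fun z => cross (p z i) (p z i.+1) / dot (p z i) (p z i.+1)) (@atan R));
    last exact: continuous_atan.
  apply: continuousM; first exact: cont_cross.
  by apply: continuousV; [rewrite gt_eqF// pd|exact: cont_dot].
move=> z Kz.
suff h n : (n <= N)%N -> has_angle (p z n)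
    (tc + \sum_(i < n) atan (cross (p z i) (p z i.+1) / dot (p z i) (p z i.+1))).
  by have := h N (leqnn N); rewrite /p divff ?gt_eqF// seg1.
elim: n => [_|n IH nN]; first by rewrite big_ord0 addr0 /p mul0r seg0.
rewrite big_ord_recr/= addrA; apply: has_angle_dot; last exact: pd.
exact: IH (ltnW nN).
Qed.

End lift.

Section star_lift.
Variable R : realType.
Implicit Types (w : R * R -> R * R) (z c : R * R) (K E : set (R * R)).

(** The union of the segments from [c] to the points of [K]: the smallest star-shaped
    set on which a lift near [K] can be built from its value at [c]. *)
Definition hull c K := (fun p : (R * R) * R => seg c p.1 p.2) @` (K `*` [set` `[0, 1 : R]]).

Lemma hull_compact c K : compact K -> compact (hull c K).
Proof.
move=> cK; apply: continuous_compact; last exact: compact_setX cK (@segment_compact _ 0 1).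
apply: continuous_subspaceT => p; apply: cont_seg; [exact: cvg_fst|exact: cvg_snd].
Qed.

Lemma hull_star c K : star_at c (hull c K).
Proof.
move=> _ t [[z s]/= [Kz]] + <- /andP[t0 t1]; rewrite in_itv/= => /andP[s0 s1].
exists (z, t * s); last by rewrite seg_seg.
by split=> //=; rewrite in_itv/= mulr_ge0//= mulr_ile1.
Qed.

Lemma sub_hull c K z : K z -> hull c K z.
Proof. by move=> Kz; exists (z, 1); rewrite ?seg1//=; split=> //=; rewrite in_itv/= ler01 lexx. Qed.

Lemma hull_sub c K E : star_at c E -> K `<=` E -> hull c K `<=` E.
Proof.
move=> sE KE _ [[z s]/= [Kz]] + <-; rewrite in_itv/= => s01.
by apply: sE => //; exact: KE.
Qed.

(** Two lifts that agree at the center agree along the segment to [z], as their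
    difference is continuous with values in the multiples of [2 pi]. This lets lifts over
    different compact sets be compared. *)
Lemma segment_lift_unique w c K1 K2 (th1 th2 : R * R -> R) z : star_at c K1 -> star_at c K2 ->
  (forall z, K1 z -> {for z, continuous th1}) -> (forall z, K2 z -> {for z, continuous th2}) ->
  (forall z, K1 z -> has_angle (w z) (th1 z)) -> (forall z, K2 z -> has_angle (w z) (th2 z)) ->
  th1 c = th2 c -> K1 z -> K2 z -> th1 z = th2 z.
Proof.
move=> s1 s2 c1 c2 a1 a2 thc K1z K2z.
suff : th1 (seg c z 1) - th2 (seg c z 1) = 0 by rewrite seg1 => /eqP; rewrite subr_eq0 => /eqP.
apply: (@cos_eq1_const _ (fun t => th1 (seg c z t) - th2 (seg c z t)) 0 1 ler01).
- apply: cont_within => t; rewrite /= in_itv/= => t01.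
  have cs : {for t, continuous (seg c z)}.
    by apply: cont_seg; [exact: cst_continuous|exact: cont_id].
  apply: continuousB.
    by apply: (@continuous_comp _ _ _ (seg c z) th1) => //; apply: c1; exact: s1.
  by apply: (@continuous_comp _ _ _ (seg c z) th2) => //; apply: c2; exact: s2.
- by move=> t t01; apply: (@has_angle_cosB _ (w (seg c z t)));
  [apply: a1; exact: s1|apply: a2; exact: s2].
- by rewrite seg0 thc subrr.
Qed.

(** Without compactness there is no uniform subdivision, so the lift is defined point
    by point, along the segment from the center. Near a given point it coincides with a
    lift over the hull of a compact neighborhood, hence it is continuous. *)
Lemma star_lift w c E tc : continuous w -> star_at c E ->
  (forall z, E z -> 0 < dot (w z) (w z)) -> has_angle (w c) tc ->
  (forall z, E z -> exists K, [/\ compact K, K `<=` E & \forall y \near z, E y -> K y]) ->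
  exists th : R * R -> R, (forall z, E z -> has_angle (w z) (th z)) /\
    forall z, E z -> th x @[x --> within E (nbhs z)] --> th z.
Proof.
move=> cw sE wE wc lE.
have H K : compact K -> K `<=` E -> exists th : R * R -> R,
    [/\ th c = tc, forall z, hull c K z -> {for z, continuous th} &
    forall z, hull c K z -> has_angle (w z) (th z)].
  move=> cK KE; apply: compact_lift => //; [exact: hull_compact|exact: hull_star|].
  by move=> z /(hull_sub sE KE); exact: wE.
have H1 z : exists th : R * R -> R, E z ->
    [/\ th c = tc, forall y, hull c [set z] y -> {for y, continuous th} &
    forall y, hull c [set z] y -> has_angle (w y) (th y)].
  have [Ez|nE] := pselect (E z); last by exists (cst 0).
  have [|th] := H [set z] (@compact_set1 _ z); first by move=> _ ->.
  by exists th.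
have [T TP] := choice H1.
have zz z : hull c [set z] z by exact: sub_hull.
exists (fun z => T z z); split=> [z Ez|z Ez].
  by have [_ _] := TP _ Ez; apply.
have [K [cK KE nK]] := lE _ Ez.
have [th [thc cth ath]] := H K cK KE.
have Tth y : E y -> K y -> T y y = th y.
  move=> Ey Ky; have [Tc cT aT] := TP _ Ey.
  apply: (@segment_lift_unique w c (hull c [set y]) (hull c K) _ _ _ _ _ cT cth aT ath) => //.
  - exact: hull_star.
  - exact: hull_star.
  - by rewrite Tc thc.
  - exact: sub_hull.
have Kz : K z by exact: (nbhs_singleton nK).
rewrite Tth//.
have : th x @[x --> within E (nbhs z)] --> th z.
  by apply: cvg_within_filter; apply: cth; exact: sub_hull.
apply: cvg_trans; apply: near_eq_cvg.
by apply: filterS nK => y Ky Ey; rewrite Tth//; exact: Ky.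
Qed.

End star_lift.

(** * The angle of the displacement field *)

Section global_angle.
Variable R : realType.
Implicit Types (h : R * R -> R * R) (z : R * R) (n : int).

(** A lift of an annulus map, extended to the plane: below and above the strip it acts
    on the abscissa as it does on the corresponding boundary line and keeps the ordinate.
    The extension makes room for arcs that begin below the annulus and end above it. *)
Record plane_lift h : Prop := PlaneLift {
  lift_continuous : continuous h;
  lift_shift : forall z, h (z.1 + 1, z.2) = ((h z).1 + 1, (h z).2);
  lift_low : forall x y, y <= 0 -> h (x, y) = ((h (x, 0)).1, y);
  lift_high : forall x y, 1 <= y -> h (x, y) = ((h (x, 1)).1, y) }.

Definition disp h z := ((h z).1 - z.1, (h z).2 - z.2).

Lemma lift_shift_int h n z : plane_lift h ->
  h (z.1 + n%:~R, z.2) = ((h z).1 + n%:~R, (h z).2).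
Proof.
move=> hl; elim/int_rec: n => [|n IH|n IH].
- by rewrite !addr0; case: z => a b /=; case: (h (a, b)).
- by rewrite -pmulrn -natr1 !addrA (lift_shift hl (z.1 + n%:R, z.2)) [n%:R]pmulrn IH.
- have := lift_shift hl (z.1 - n.+1%:R, z.2).
  have -> : (z.1 - n.+1%:R, z.2).1 + 1 = z.1 - n%:R by rewrite /= -natr1; ring.
  move: IH; rewrite !mulrNz -!pmulrn /= => -> [e1 e2].
  move: e1 e2; case: (h (_ - _, _)) => a b /= e1 ->; congr (_, _).
  by rewrite -natr1; lra.
Qed.

Lemma disp_shift_int h n z : plane_lift h -> disp h (z.1 + n%:~R, z.2) = disp h z.
Proof. by move=> hl; rewrite /disp lift_shift_int//=; congr (_, _); ring. Qed.

Lemma disp_dot_gt0 h z : h z <> z -> 0 < dot (disp h z) (disp h z).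
Proof.
move=> hz; rewrite /dot -!expr2 lt_neqAle addr_ge0 ?sqr_ge0// andbT eq_sym.
rewrite paddr_eq0 ?sqr_ge0// !sqrf_eq0 !subr_eq0; apply/negP => /andP[/eqP a /eqP b].
by apply: hz; move: a b; case: (h z); case: z => ? ? ? ? /= -> ->.
Qed.

Lemma dot_gt0_disp h z : 0 < dot (disp h z) (disp h z) -> h z <> z.
Proof. by move=> + hz; rewrite /disp hz /dot !subrr !mulr0 addr0 ltxx. Qed.

Lemma disp_continuous h : continuous h -> continuous (disp h).
Proof.
move=> ch z; suff : {for z, continuous (disp h)} by [].
apply: cont_pair; apply: continuousB.
- by apply: cont_fst; exact: ch.
- exact: cvg_fst.
- by apply: cont_snd; exact: ch.
- exact: cvg_snd.
Qed.

Lemma near_nonfixed h z : continuous h -> h z <> z -> \forall y \near z, h y <> y.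
Proof.
move=> ch /disp_dot_gt0 hz.
have : {for z, continuous (fun z => dot (disp h z) (disp h z))}.
  by by apply: cont_dot; exact: disp_continuous.
move=> /cvgr_gt /(_ _ hz) /=; apply: filterS => y; exact: dot_gt0_disp.
Qed.

Lemma has_angle_horizontal (v w : R * R) t : has_angle v t -> v.2 = 0 -> w.2 = 0 ->
  0 < v.1 * w.1 -> has_angle w t.
Proof.
case: v => p q [r r0 [-> ->]] /= s0; case: w => p' q' /= -> h.
have st : sin t = 0 by apply/eqP; move/eqP: s0; rewrite mulf_eq0 (gt_eqF r0).
have : 0 < cos t * p' by move: h; rewrite -mulrA pmulr_rgt0.
have ct : cos t ^+ 2 = 1 by rewrite cos2sin2 st expr0n subr0.
move=> cp; exists (cos t * p') => //.
by rewrite st mulr0 mulrAC -expr2 ct mul1r.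
Qed.

Lemma within_path (T : topologicalType) (E : set T) (th : T -> R) (p : R -> T) (a b : R) :
  (forall x, E x -> th y @[y --> within E (nbhs x)] --> th x) ->
  (forall t, a <= t <= b -> E (p t)) -> continuous p ->
  {within `[a, b], continuous (th \o p)}.
Proof.
move=> cth Ep cp; apply/subspace_continuousP => t /=; rewrite in_itv/= => tab.
apply: (@cvg_comp _ _ _ p th _ (within E (nbhs (p t)))); last exact: cth (Ep _ tab).
move=> A; rewrite /within/= => /cp; rewrite /= !near_simpl.
by apply: filterS => s As; rewrite /= in_itv/= => /Ep; exact: As.
Qed.

(** The reversed form of the constancy principle, for paths followed from their known
    end. *)
Lemma cos_eq1_constr (u : R -> R) a b : a <= b -> {within `[a, b], continuous u} ->
  (forall t, a <= t <= b -> cos (u t) = 1) -> u b = 0 -> u a = 0.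
Proof.
move=> ab cu c1 ub; have s1 t : a <= t <= b -> sin (u t) = 0.
  by move=> /c1 h; apply: cos1sin0; rewrite h normr1.
have aab : a <= a <= b by rewrite lexx.
suff : u b - u a = 0 by rewrite ub; lra.
apply: (@cos_eq1_const _ (fun t => u t - u a) a b ab).
- move=> t; apply: continuousB; [exact: cu|exact: cst_continuous].
- by move=> t tab; rewrite cosB !c1// !s1// mulr1 mulr0 addr0.
- exact: subrr.
Qed.

End global_angle.

Section column.
Variables (R : realType) (h : R * R -> R * R) (x0 y0 : R).
Hypothesis h_lift : plane_lift h.
Hypothesis twist0 : forall x, (h (x, 0)).1 < x.
Hypothesis twist1 : forall x, x < (h (x, 1)).1.
Hypothesis h_fix : forall z, h z = z -> z.2 = y0 /\ exists n : int, z.1 = x0 + n%:~R.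

(** A fundamental domain whose two edges carry all possible fixed points. The
    points to be avoided then lie on the boundary, so that the rest is star-shaped. *)
Definition column := [set z : R * R | x0 <= z.1 <= x0 + 1 /\ h z <> z].

Lemma nonfixed_inside z : x0 < z.1 < x0 + 1 -> h z <> z.
Proof.
move=> z01 /h_fix[_ [n zn]]; move: z01; rewrite zn ltrDl ltrD2l => /andP[].
by rewrite ltr0z gtz0_ge1 -[X in _ < X](mulr1z 1) ltr_int leNgt => /negP.
Qed.

Lemma nonfixed_low z : z.2 <= 0 -> h z <> z.
Proof.
case: z => x y /= y0' hz; have := twist0 x; have := lift_low h_lift x y0'.
by rewrite hz => -[<-]; rewrite ltxx.
Qed.

Lemma nonfixed_high z : 1 <= z.2 -> h z <> z.
Proof.
case: z => x y /= y0' hz; have := twist1 x; have := lift_high h_lift x y0'.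
by rewrite hz => -[<-]; rewrite ltxx.
Qed.

Lemma disp_low z : z.2 <= 0 -> (disp h z).1 < 0 /\ (disp h z).2 = 0.
Proof.
case: z => x y /= yl; rewrite /disp (lift_low h_lift)//= subrr.
by split=> //; rewrite subr_lt0.
Qed.

Lemma disp_high z : 1 <= z.2 -> 0 < (disp h z).1 /\ (disp h z).2 = 0.
Proof.
case: z => x y /= yl; rewrite /disp (lift_high h_lift)//= subrr.
by split=> //; rewrite subr_gt0.
Qed.

(** A segment from the center of the base stays strictly between the two edges, where
    nothing is fixed, until it possibly reaches an edge at its end. *)
Lemma column_star : star_at (x0 + 2^-1, 0) column.
Proof.
move=> z t [zx hz] /andP[t0]; rewrite le_eqVlt => /orP[/eqP->|t1].
  by rewrite seg1.
have zin : x0 < (seg (x0 + 2^-1, 0) z t).1 < x0 + 1.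
  by rewrite /seg /=; move: zx => /andP[? ?]; apply/andP; split; nra.
split; last exact: nonfixed_inside.
by case/andP: zin => *; rewrite !ltW.
Qed.

Lemma column_locally_compact z : column z ->
  exists K, [/\ compact K, K `<=` column & \forall y \near z, column y -> K y].
Proof.
move=> [zx hz]; have /nbhs_ballP[e /= e0 ez] := near_nonfixed (lift_continuous h_lift) hz.
pose I (x : R) := [set` `[x - e / 2, x + e / 2]].
exists (([set` `[x0, x0 + 1]] `&` I z.1) `*` I z.2); split.
- apply: compact_setX; last exact: segment_compact.
  apply: compact_closedI; first exact: segment_compact.
  exact: interval_closed.
- move=> [x y] [[/= x01 xz] yz]; split; first by move: x01; rewrite in_itv.
  apply: ez; move: xz yz; rewrite /I /= !in_itv/= => /andP[? ?] /andP[? ?].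
  by split; rewrite /= /ball /= ltr_norml; apply/andP; split; lra.
- have e2 : 0 < e / 2 by lra.
  apply/nbhs_ballP; exists (e / 2) => //= y [b1 b2] [yx hy].
  move: b1 b2; rewrite /ball /= !ltr_norml => /andP[? ?] /andP[? ?].
  by split; [split|]; rewrite /I /= in_itv/=; (try exact: yx); apply/andP; split; lra.
Qed.

Lemma column_angle : exists th : R * R -> R,
  (forall z, column z -> has_angle (disp h z) (th z)) /\
  forall z, column z -> th x @[x --> within column (nbhs z)] --> th z.
Proof.
apply: (@star_lift _ (disp h) (x0 + 2^-1, 0) column pi).
- exact: disp_continuous (lift_continuous h_lift).
- exact: column_star.
- by move=> z [_ /disp_dot_gt0].
- have [d1 d2] := @disp_low (x0 + 2^-1, 0) (lexx 0).
  exists (- (disp h (x0 + 2^-1, 0)).1); first by rewrite oppr_gt0.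
  by move: d2; rewrite cospi sinpi mulrN1 opprK mulr0; case: (disp _ _) => a b /= ->.
- exact: column_locally_compact.
Qed.

Lemma nonfixed_shift (n : int) z : h z <> z <-> h (z.1 + n%:~R, z.2) <> (z.1 + n%:~R, z.2).
Proof.
split=> hz ez; apply: hz; last by rewrite lift_shift_int// ez.
move: ez; rewrite lift_shift_int// => -[/addIr e1 e2].
by move: e1 e2; case: (h z); case: z => ? ? ? ? /= -> ->.
Qed.

Section glue.
Variable th : R * R -> R.
Hypothesis th_angle : forall z, column z -> has_angle (disp h z) (th z).
Hypothesis th_cont : forall z, column z -> th x @[x --> within column (nbhs z)] --> th z.

(** As long as the displacement stays horizontal and keeps its direction, its angle
    cannot change. *)
Lemma column_const c z : c.1 = x0 ->
  (forall t, 0 <= t <= 1 -> h (seg c z t) <> seg c z t) ->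
  (forall t, 0 <= t <= 1 -> (disp h (seg c z t)).2 = 0 /\
     0 < (disp h c).1 * (disp h (seg c z t)).1) ->
  x0 <= z.1 <= x0 + 1 -> th z = th c.
Proof.
move=> c1 hn hd zx.
have col t : 0 <= t <= 1 -> column (seg c z t).
  move=> t01; split; last exact: hn.
  move: t01 zx => /andP[? ?] /andP[? ?].
  by rewrite /seg /= c1; apply/andP; split; nra.
suff : th (seg c z 1) - th c = 0 by rewrite seg1 => /eqP; rewrite subr_eq0 => /eqP.
apply: (@cos_eq1_const _ (fun t => th (seg c z t) - th c) 0 1 ler01).
- move=> t; apply: continuousB; last exact: cst_continuous.
  apply: (@within_path _ _ column th (seg c z)) => // s.
  by apply: cont_seg; [exact: cst_continuous|exact: cont_id].
- move=> t t01; apply: (@has_angle_cosB _ (disp h (seg c z t))).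
    by apply: th_angle; exact: col.
  apply: (@has_angle_horizontal _ (disp h c)).
  + rewrite -[in th _](seg0 c z) -[c in disp h c](seg0 c z); apply: th_angle; apply: col.
    by rewrite lexx ler01.
  + by rewrite -(seg0 c z); have [] := hd 0; rewrite ?lexx ?ler01.
  + by have [] := hd _ t01.
  + by have [] := hd _ t01.
- by rewrite seg0 subrr.
Qed.

Lemma column_low z : x0 <= z.1 <= x0 + 1 -> z.2 <= 0 -> th z = th (x0, 0).
Proof.
move=> zx z2; have low t : 0 <= t <= 1 -> (seg (x0, 0) z t).2 <= 0.
  by move=> /andP[? ?]; rewrite /seg /=; nra.
apply: column_const => // t t01; first exact: nonfixed_low (low _ t01).
have [d1 d2] := disp_low (low _ t01).
by have [d3 _] := @disp_low (x0, 0) (lexx 0); rewrite nmulr_rgt0.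
Qed.

Lemma column_high z : x0 <= z.1 <= x0 + 1 -> 1 <= z.2 -> th z = th (x0, 1).
Proof.
move=> zx z2; have high t : 0 <= t <= 1 -> 1 <= (seg (x0, 1) z t).2.
  by move=> /andP[? ?]; rewrite /seg /=; nra.
apply: column_const => // t t01; first exact: nonfixed_high (high _ t01).
have [d1 d2] := disp_high (high _ t01).
by have [d3 _] := @disp_high (x0, 1) (lexx 1); rewrite pmulr_rgt0.
Qed.

(** The fixed point has index zero. The jump of the angle between the two edges is
    constant on either side of the height [y0], and it vanishes far below and far above,
    where the displacement is horizontal with a constant direction. *)
Lemma column_edges y : h (x0, y) <> (x0, y) -> th (x0 + 1, y) = th (x0, y).
Proof.
move=> hy; pose u t := th (x0 + 1, t) - th (x0, t).
suff : u y = 0 by move/eqP; rewrite subr_eq0 => /eqP.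
have col t : h (x0, t) <> (x0, t) -> column (x0, t) /\ column (x0 + 1, t).
  move=> ht; split; split=> //=; rewrite ?lexx ?lerDl ?ler01//.
  by have /(nonfixed_shift 1) := ht; rewrite mulr1z.
have cu a b : (forall t, a <= t <= b -> h (x0, t) <> (x0, t)) ->
    {within `[a, b], continuous u}.
  move=> hab t; apply: continuousB.
    apply: (@within_path _ _ column th (fun t => (x0 + 1, t))) => //.
      by move=> s /hab/col[].
    by move=> s; exact: (cont_pair (@cst_continuous _ _ _ _) (@cont_id _ s)).
  apply: (@within_path _ _ column th (fun t => (x0, t))) => //.
    by move=> s /hab/col[].
  by move=> s; exact: (cont_pair (@cst_continuous _ _ _ _) (@cont_id _ s)).
have c1 t : h (x0, t) <> (x0, t) -> cos (u t) = 1.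
  move=> /col[k1 k2]; apply: (@has_angle_cosB _ (disp h (x0, t))); last exact: th_angle.
  by have := @disp_shift_int _ h 1 (x0, t) h_lift; rewrite mulr1z /= => <-; exact: th_angle.
have x01 : x0 <= x0 + 1 by rewrite lerDl.
have [yy0|yy0] := leP y y0.
  have nf t : Num.min y 0 <= t <= y -> h (x0, t) <> (x0, t).
    move=> /andP[_ ty] ht; have [/= ty0 _] := h_fix ht.
    by apply: hy; rewrite (_ : y = t)//; apply/eqP; rewrite eq_le ty ty0 yy0.
  apply: (@cos_eq1_const _ u (Num.min y 0) y) => //.
  - by rewrite ge_min lexx.
  - exact: cu.
  - by move=> t /nf; exact: c1.
  - have m0 : Num.min y 0 <= 0 by rewrite ge_min lexx orbT.
    by rewrite /u !column_low ?subrr//= ?x01 ?lexx.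
have nf t : y <= t <= Num.max y 1 -> h (x0, t) <> (x0, t).
  move=> /andP[ty _] ht; have [/= ty0 _] := h_fix ht.
  by move: ty; rewrite ty0 leNgt yy0.
apply: (@cos_eq1_constr _ u y (Num.max y 1)) => //.
- by rewrite le_max lexx.
- exact: cu.
- by move=> t /nf; exact: c1.
- have m0 : 1 <= Num.max y 1 by rewrite le_max lexx orbT.
  by rewrite /u !column_high ?subrr//= ?x01 ?lexx.
Qed.

Definition unroll z := th (z.1 - (Num.floor (z.1 - x0))%:~R, z.2).

Lemma unrollE (n : int) z : x0 + n%:~R <= z.1 <= x0 + n%:~R + 1 -> h z <> z ->
  unroll z = th (z.1 - n%:~R, z.2).
Proof.
move=> /andP[z1 z2] hz; rewrite /unroll; have [zlt|zge] := ltP z.1 (x0 + n%:~R + 1).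
  rewrite (@floor_def _ _ n)//; apply/andP; split; first by rewrite lerBrDl.
  by rewrite intrD1; lra.
have ez : z.1 = x0 + n%:~R + 1 by lra.
rewrite (@floor_def _ _ (n + 1)); last by rewrite !intrD !mulr1z ez; apply/andP; split; lra.
rewrite intrD mulr1z -[RHS](_ : th (x0 + 1, z.2) = _); last by congr (th (_, _)); lra.
rewrite column_edges; first by congr (th (_, _)); lra.
have /(nonfixed_shift (- (n + 1))) := hz.
by rewrite mulrNz intrD mulr1z (_ : z.1 - (n%:~R + 1) = x0)//; lra.
Qed.

Lemma column_shift (n : int) z : x0 + n%:~R <= z.1 <= x0 + n%:~R + 1 -> h z <> z ->
  column (z.1 - n%:~R, z.2).
Proof.
move=> z01 hz; split; first by move: z01 => /= /andP[? ?]; apply/andP; split; lra.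
by have /(nonfixed_shift (- n)) := hz; rewrite mulrNz.
Qed.

(** On the common edge of two columns the two formulas agree, so it is enough to
    control the angle on each of the two closed columns separately. *)
Lemma unroll_cont z : h z <> z -> {for z, continuous unroll}.
Proof.
move=> hz; have near_n (n : int) : x0 + n%:~R <= z.1 <= x0 + n%:~R + 1 ->
    forall e, 0 < e -> \forall y \near z, x0 + n%:~R <= y.1 <= x0 + n%:~R + 1 ->
      `|unroll z - unroll y| < e.
  move=> zn e e0; have cz := column_shift zn hz.
  have /cvgrPdist_lt/(_ e e0) := th_cont cz.
  rewrite near_withinE => nth.
  have csub : {for z, continuous (fun y : R * R => (y.1 - n%:~R, y.2))}.
    apply: cont_pair; last exact: cvg_snd.
    by apply: continuousB; [exact: cvg_fst|exact: cst_continuous].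
  have := csub _ nth; rewrite /= !near_simpl => ny.
  have := near_nonfixed (lift_continuous h_lift) hz.
  apply: filterS2 ny => y h1 h2 yn; rewrite !(@unrollE n)//.
  by apply: h1; exact: column_shift.
have c1 : {for z, continuous (fun y : R * R => y.1)} by exact: cvg_fst.
pose n := Num.floor (z.1 - x0).
have [n1 n2] : x0 + n%:~R <= z.1 /\ z.1 < x0 + n%:~R + 1.
  have := floor_itv (z.1 - x0); rewrite -/n intrD1 => /andP[? ?].
  by split; lra.
have zn : x0 + n%:~R <= z.1 <= x0 + n%:~R + 1 by rewrite n1 ltW.
apply/cvgrPdist_lt => e e0.
have nr := near_n n zn e e0.
have ur : \forall y \near z, y.1 < x0 + n%:~R + 1 by exact: (cvgr_lt _ c1).
have [zgt|zle] := ltP (x0 + n%:~R) z.1.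
  have ul : \forall y \near z, x0 + n%:~R < y.1 by exact: (cvgr_gt _ c1).
  near=> y.
  have yr : y.1 < x0 + n%:~R + 1 by near: y.
  have yl : x0 + n%:~R < y.1 by near: y.
  have yn : x0 + n%:~R <= y.1 <= x0 + n%:~R + 1 -> `|unroll z - unroll y| < e by near: y.
  by apply: yn; rewrite !ltW.
have ez : z.1 = x0 + n%:~R by apply/eqP; rewrite eq_le zle n1.
have nl : \forall y \near z, x0 + (n - 1)%:~R <= y.1 <= x0 + (n - 1)%:~R + 1 ->
    `|unroll z - unroll y| < e.
  apply: near_n => //; rewrite intrB mulr1z ez; apply/andP; split; lra.
have ul : \forall y \near z, x0 + n%:~R - 1 < y.1.
  by apply: (cvgr_gt _ c1); rewrite ez; lra.
near=> y.
have yr : y.1 < x0 + n%:~R + 1 by near: y.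
have yl : x0 + n%:~R - 1 < y.1 by near: y.
have yn : x0 + n%:~R <= y.1 <= x0 + n%:~R + 1 -> `|unroll z - unroll y| < e by near: y.
have ym : x0 + (n - 1)%:~R <= y.1 <= x0 + (n - 1)%:~R + 1 -> `|unroll z - unroll y| < e.
  by near: y.
move: ym; rewrite intrB mulr1z => ym.
have [ylt|yge] := ltP y.1 (x0 + n%:~R).
  by apply: ym; apply/andP; split; lra.
by apply: yn; rewrite yge ltW.
Unshelve. all: by end_near.
Qed.

End glue.

(** The displacement of a twist map whose fixed points project to a single point has an
    angle that is continuous off the fixed points. It is constant below and above the
    annulus, and the two constants measure how much the displacement turns across the
    annulus. *)
Lemma global_angle : exists (th : R * R -> R) (a b : R),
  [/\ forall z, h z <> z -> has_angle (disp h z) (th z),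
      forall z, h z <> z -> {for z, continuous th},
      forall z, z.2 <= 0 -> th z = a & forall z, 1 <= z.2 -> th z = b].
Proof.
have [th [ath cth]] := column_angle.
have fl (z : R * R) : x0 + (Num.floor (z.1 - x0))%:~R <= z.1 <= x0 + (Num.floor (z.1 - x0))%:~R + 1.
  have := floor_itv (z.1 - x0); rewrite intrD1 => /andP[? ?].
  by apply/andP; split; lra.
have fl2 (z : R * R) : x0 <= z.1 - (Num.floor (z.1 - x0))%:~R <= x0 + 1.
  by have /andP[? ?] := fl z; apply/andP; split; lra.
exists (unroll th), (th (x0, 0)), (th (x0, 1)); split=> z hz.
- have := disp_shift_int (- Num.floor (z.1 - x0)) z h_lift.
  rewrite mulrNz => <-; apply: ath.
  exact: column_shift.
- exact: unroll_cont.
- by apply: (column_low ath cth) => //=; exact: fl2.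
- by apply: (column_high ath cth) => //=; exact: fl2.
Qed.

End column.

(** * The arc followed by the dynamics *)

Section curve.
Variables (R : realType) (T : R * R -> R * R) (c0 : R -> R * R).
Hypothesis T_cont : continuous T.
Hypothesis c0_cont : continuous c0.
Hypothesis c0_end : c0 1 = T (c0 0).

(** An arc on which [T] acts as the unit shift of the parameter, built from a
    fundamental piece [c0]. Writing the concatenation as a sum of clamped pieces makes its
    continuity immediate. *)
Fixpoint flow_arc n (t : R) : R * R :=
  if n is n'.+1 then c0 (Num.min t 1) + T (flow_arc n' (Num.max t 1 - 1)) - c0 1 else c0 t.

Lemma flow_arc_cont n : continuous (flow_arc n).
Proof.
elim: n => [|n IH] t //=.
suff : {for t, continuous (fun t : R => c0 (Num.min t 1) + T (flow_arc n
  (Num.max t 1 - 1)) - c0 1)} by [].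
have cm : {for t, continuous (fun t : R => Num.min t 1)}.
  by apply: cont_min; [exact: cont_id|exact: cst_continuous].
have cM : {for t, continuous (fun t : R => Num.max t 1 - 1)}.
  apply: continuousB; last exact: cst_continuous.
  by apply: cont_max; [exact: cont_id|exact: cst_continuous].
apply: continuousB; last exact: cst_continuous.
apply: continuousD.
  by apply: (@continuous_comp _ _ _ (fun t : R => Num.min t 1) c0) => //; exact: c0_cont.
apply: (@continuous_comp _ _ _ (fun t : R => flow_arc n (Num.max t 1 - 1)) T); last exact: T_cont.
by apply: (@continuous_comp _ _ _ (fun t : R => Num.max t 1 - 1) (flow_arc n)) => //; exact: IH.
Qed.

Lemma flow_arc_le1 n t : t <= 1 -> flow_arc n t = c0 t.
Proof.
elim: n t => //= n IH t t1.
by rewrite min_l// max_r// subrr IH// -c0_end addrK.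
Qed.

Lemma flow_arc_ge1 n t : 1 <= t -> flow_arc n.+1 t = T (flow_arc n (t - 1)).
Proof. by move=> t1; rewrite /= min_r// max_l// addrC addKr. Qed.

Lemma flow_arc_stable n t : t <= n.+1%:R -> flow_arc n.+1 t = flow_arc n t.
Proof.
elim: n t => [|n IH] t tn; first by rewrite !flow_arc_le1.
have [t1|t1] := leP t 1; first by rewrite !flow_arc_le1.
by rewrite (@flow_arc_ge1 n.+1 t) ?(@flow_arc_ge1 n t) ?(ltW t1)// IH// lerBlDr natr1.
Qed.

Lemma flow_arc_exists n : exists C : R -> R * R, [/\ continuous C,
  forall t, t <= 1 -> C t = c0 t & forall t, 1 <= t <= n%:R -> C t = T (C (t - 1))].
Proof.
exists (flow_arc n.+1); split; first exact: flow_arc_cont.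
  exact: flow_arc_le1.
move=> t /andP[t1 tn]; rewrite flow_arc_ge1// flow_arc_stable//.
by rewrite -natr1; lra.
Qed.

End curve.

Section first_time.
Variable R : realType.

Lemma first_time (u : R -> R) (n c : R) : continuous u -> 0 <= n -> u 0 < c -> c <= u n ->
  exists t, [/\ 0 <= t <= n, u t = c & forall s, 0 <= s < t -> u s < c].
Proof.
move=> cu n0 u0 un; pose A := [set` `[0, n]] `&` [set t | c <= u t].
have cA : compact A.
  apply: compact_closedI; first exact: segment_compact.
  exact: (closed_comp (fun x _ => cu x) (@closed_ge _ c)).
have An : A n by split => //=; rewrite in_itv/= n0 lexx.
have [|t /set_mem[]] := @compact_EVT_min _ R id A _ cA (continuous_subspaceT (@cont_id _)).
  by exists n.
rewrite /= in_itv/= => /andP[t0 tn] ut tmin.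
have lt s : 0 <= s < t -> u s < c.
  move=> /andP[s0 st]; rewrite ltNge; apply/negP => us.
  have := tmin s (mem_set _); rewrite leNgt st => h.
  by apply: notF; apply: h; split=> //=; rewrite in_itv/= s0 (le_trans (ltW st)).
exists t; split => //; first by rewrite t0.
apply/eqP; rewrite eq_le ut andbT leNgt; apply/negP => cut.
have [|s] := @IVT R u 0 t c t0 (continuous_subspaceT cu).
  by rewrite ge_min le_max (ltW u0) ut orbT.
rewrite in_itv/= => /andP[s0 st] us.
have := lt s; rewrite us ltxx s0 lt_neqAle st andbT.
case: eqVneq => [e _|_ /(_ isT)//]; by move: cut; rewrite -e us ltxx.
Qed.

End first_time.

Section simple_arc.
Variables (R : realType) (h k : R * R -> R * R) (phi : R -> R).
Hypothesis h_lift : plane_lift h.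
Hypothesis k_lift : plane_lift k.
Hypothesis hK : cancel h k.
Hypothesis kK : cancel k h.
Hypothesis twist0 : forall x, (h (x, 0)).1 < x.
Hypothesis phi_cont : continuous phi.
Hypothesis phi_ge0 : forall x, 0 <= phi x.

Definition push (z : R * R) := ((h z).1, (h z).2 + phi (h z).1).

Lemma push_inj : injective push.
Proof.
move=> z w [e1]; rewrite e1 => /addIr e2; apply: (can_inj hK).
by move: e1 e2; case: (h z); case: (h w) => ? ? ? ? /= -> ->.
Qed.

Lemma push_cont : continuous push.
Proof.
move=> z; suff : {for z, continuous push} by [].
have c1 : {for z, continuous (fun z => (h z).1)}.
  by apply: cont_fst; exact: (lift_continuous h_lift).
apply: cont_pair => //; apply: continuousD.
  by apply: cont_snd; exact: (lift_continuous h_lift).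
by apply: (@continuous_comp _ _ _ (fun z => (h z).1) phi) => //; exact: phi_cont.
Qed.

Lemma lift_lowE (g : R * R -> R * R) z : plane_lift g -> z.2 <= 0 ->
  g z = ((g (z.1, 0)).1, z.2).
Proof. by case: z => x y hg /= yl; exact: lift_low. Qed.

Lemma low_of_low_image z : (h z).2 <= 0 -> z.2 <= 0.
Proof. by move=> hz; have := lift_lowE k_lift hz; rewrite hK => ->. Qed.

(** A continuous injective map of the line that commutes with a translation is
    increasing: otherwise some value would be taken a second time further to the left. *)
Lemma boundary_mono x x' : x <= x' -> (h (x, 0)).1 <= (h (x', 0)).1.
Proof.
move=> xx'; rewrite leNgt; apply/negP => lt.
pose g (t : R) := (h (t, 0)).1.
have cg : continuous g.
  move=> t; apply: (@cont_fst _ _ (fun t : R => h (t, 0))).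
  apply: (@continuous_comp _ _ _ (fun t : R => (t, 0)) h); last exact: (lift_continuous h_lift).
  exact: (cont_pair (@cont_id _ t) (@cst_continuous _ _ _ _)).
have g_inj t t' : g t = g t' -> t = t'.
  move=> e; suff [] : (t, 0) = (t', 0 : R) by [].
  apply: (can_inj hK).
  by rewrite (lift_low h_lift t (lexx 0)) (lift_low h_lift t' (lexx 0)) -/(g t) e.
pose n := Num.bound (g x - g x').
have gn : g (x - n%:R) < g x'.
  have := lift_shift_int (- n%:Z) (x, 0) h_lift.
  rewrite /g mulrNz -pmulrn /= => -> /=.
  rewrite ltrBlDr -ltrBlDl; apply: archi_boundP; rewrite subr_ge0; exact: ltW.
have xn : x - n%:R <= x by rewrite lerBlDr lerDl.
have [|s] := @IVT R g (x - n%:R) x (g x') xn (continuous_subspaceT cg).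
  by rewrite ge_min le_max (ltW gn) (ltW lt) orbT.
rewrite in_itv/= => /andP[_ sx] /g_inj e.
have exx : x = x' by lra.
by move: lt; rewrite exx ltxx.
Qed.

Variable z0 : R * R.
Hypothesis z0_low : z0.2 <= 0.
Let a0 := z0.1.
Let a1 := (h z0).1.

Lemma a1_lt : a1 < a0.
Proof. by rewrite /a1 (lift_lowE h_lift z0_low)/=; exact: twist0. Qed.

(** Its abscissa moves monotonically from that of [z0] to that of its image, and it stays
    inside the image of the lower half-plane under the sheared map. These two facts are
    what makes the iterated arc simple. *)
Definition first_arc (t : R) :=
  (a0 + t * (a1 - a0), z0.2 + t * phi (a0 + t * (a1 - a0))).

Lemma first_arc_cont : continuous first_arc.
Proof.
move=> t; suff : {for t, continuous first_arc} by [].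
have cx : {for t, continuous (fun t : R => a0 + t * (a1 - a0))}.
  apply: continuousD; first exact: cst_continuous.
  by apply: continuousM; [exact: cont_id|exact: cst_continuous].
apply: cont_pair => //; apply: continuousD; first exact: cst_continuous.
apply: continuousM; first exact: cont_id.
by apply: (@continuous_comp _ _ _ (fun t : R => a0 + t * (a1 - a0)) phi) => //; exact: phi_cont.
Qed.

Lemma first_arc0 : first_arc 0 = z0.
Proof. by rewrite /first_arc !mul0r !addr0 /a0; case: z0. Qed.

Lemma first_arc1 : first_arc 1 = push (first_arc 0).
Proof.
have e2 : (h z0).2 = z0.2 by rewrite (lift_lowE h_lift z0_low).
by rewrite first_arc0 /push /first_arc !mul1r e2 addrC subrK.
Qed.

Variables (N : R) (C : R -> R * R).
Hypothesis C_first : forall t, t <= 1 -> C t = first_arc t.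
Hypothesis C_push : forall t, 1 <= t <= N -> C t = push (C (t - 1)).

(** A point of the arc in the image of the lower half-plane comes from the lower
    half-plane, where the map moves abscissas to the left; so such a point is at least as
    far to the left as the end of the first piece. *)
Lemma arc_left t : 1 <= t <= N -> (C t).2 <= phi (C t).1 -> (C t).1 <= a1.
Proof.
have [n] : exists n : nat, t <= n%:R + 1.
  exists (Num.bound `|t|); rewrite (le_trans (ler_norm t))// ler_wpDr//.
  by rewrite ltW// archi_boundP.
elim: n t => [|n IH] t tn /andP[t1 tN] Ct.
  have -> : t = 1 by apply/eqP; rewrite eq_le t1 andbT; move: tn; rewrite mulr0n add0r.
  by rewrite C_first// /first_arc mul1r addrC subrK.
have e : C t = push (C (t - 1)) by rewrite C_push// t1.
move: Ct; rewrite e /push /= gerDr => /low_of_low_image Cl.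
rewrite (lift_lowE h_lift Cl)/=.
have [s1|s1] := leP (t - 1) 1.
  have a1E : a1 = (h (z0.1, 0)).1 by rewrite /a1 (lift_lowE h_lift z0_low).
  rewrite [leRHS]a1E C_first//; apply: boundary_mono; rewrite /first_arc /=.
  by have := a1_lt; rewrite -/a0 => ?; nra.
apply: le_trans (ltW (twist0 _)) _; apply: IH.
- by move: tn; rewrite -natr1 => ?; lra.
- by apply/andP; split; lra.
- exact: le_trans Cl (phi_ge0 _).
Qed.

(** Shifting both parameters back reduces a double point to one on the first piece,
    which lies in the image of the lower half-plane and strictly to the right of every
    later point of that region. *)
Lemma arc_simple s t : 0 <= s -> s < t -> t <= N -> C s <> C t.
Proof.
have [n] : exists n : nat, s < n%:R.
  exists (Num.bound `|s|); rewrite (le_lt_trans (ler_norm s))//.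
  by rewrite archi_boundP.
elim: n s t => [|n IH] s t sn s0 st tN; first by exfalso; move: sn; rewrite mulr0n => ?; lra.
have [s1|s1] := ltP s 1.
  have Cs := C_first (ltW s1); rewrite Cs => e.
  have [t1|t1] := leP t 1.
    move: e; rewrite C_first// => -[e _].
    have := a1_lt => ?; nra.
  have : (C t).1 <= a1.
    apply: arc_left; first by rewrite (ltW t1).
    by rewrite -e /first_arc /= -[leRHS]add0r lerD// ler_piMl// ltW.
  by rewrite -e /first_arc /=; have := a1_lt => ?; nra.
rewrite (@C_push s); last by apply/andP; split; lra.
rewrite (@C_push t); last by apply/andP; split; lra.
by move=> /push_inj; apply: IH; move: sn; rewrite -natr1 => ?; lra.
Qed.

End simple_arc.

(** * The turning of the displacement along the arc *)

Section angle_drop.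
Variables (R : realType) (h k : R * R -> R * R) (phi : R -> R) (th : R * R -> R) (a b : R).
Hypothesis h_lift : plane_lift h.
Hypothesis k_lift : plane_lift k.
Hypothesis hK : cancel h k.
Hypothesis kK : cancel k h.
Hypothesis twist0 : forall x, (h (x, 0)).1 < x.
Hypothesis twist1 : forall x, x < (h (x, 1)).1.
Hypothesis phi_cont : continuous phi.
Hypothesis phi_ge0 : forall x, 0 <= phi x.
Hypothesis phi_lt1 : forall x, phi x < 1.
Hypothesis phi_fix : forall z, h z = z -> phi z.1 = 0.
Hypothesis phi_small : forall z, h z <> z -> (h z).1 = z.1 -> phi z.1 < `|(h z).2 - z.2|.
Hypothesis phi_top : forall x y, 1 - phi x <= y -> (k (x, y)).1 < x.
Hypothesis th_angle : forall z, h z <> z -> has_angle (disp h z) (th z).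
Hypothesis th_cont : forall z, h z <> z -> {for z, continuous th}.
Hypothesis th_low : forall z, z.2 <= 0 -> th z = a.
Hypothesis th_high : forall z, 1 <= z.2 -> th z = b.

Lemma cos_sin_low : cos a = -1 /\ sin a = 0.
Proof.
have z2 : (0 : R, 0 : R).2 <= 0 by exact: lexx.
have [r r0 e] := th_angle (nonfixed_low h_lift twist0 z2).
have [d1 d2] := disp_low h_lift twist0 z2.
move: d1 d2; rewrite e th_low//= pmulr_rlt0// => ca /eqP.
rewrite mulf_eq0 (gt_eqF r0)/= => /eqP sa; split=> //.
have := sin0cos1 sa; rewrite ltr0_norm// => <-; by rewrite opprK.
Qed.

Lemma cos_sin_high : cos b = 1 /\ sin b = 0.
Proof.
have z2 : 1 <= (0 : R, 1 : R).2 by exact: lexx.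
have [r r0 e] := th_angle (nonfixed_high h_lift twist1 z2).
have [d1 d2] := disp_high h_lift twist1 z2.
move: d1 d2; rewrite e th_high//= pmulr_rgt0// => ca /eqP.
rewrite mulf_eq0 (gt_eqF r0)/= => /eqP sa; split=> //.
by have := sin0cos1 sa; rewrite gtr0_norm.
Qed.

(** In this region the displacement points to the right, so its angle stays within a
    right angle of its value above the annulus. *)
Lemma angle_near_top x y : 1 - phi x <= y -> y <= 1 -> - (pi / 2) < th (k (x, y)) - b < pi / 2.
Proof.
move=> y1 y2; have [cb sb] := cos_sin_high; have pi0 := pi_gt0 R.
have nf t : 1 - phi x <= t -> h (k (x, t)) <> k (x, t).
  by move=> xt; rewrite kK => e; have := phi_top xt; rewrite -e ltxx.
have cu t : 1 - phi x <= t -> 0 < cos (th (k (x, t)) - b).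
  move=> xt; rewrite cosB cb sb mulr1 mulr0 addr0.
  rewrite (has_angle_cos (th_angle (nf _ xt))) /disp kK /= subr_gt0.
  exact: phi_top.
apply: cos_gt0_small; last exact: cu.
have -> : y = 1 - (1 - y) by lra.
have y10 : 0 <= 1 - y by lra.
apply: (@cos_stay _ (fun r => th (k (x, 1 - r)) - b) 0 (1 - y) y10).
- apply: cont_within => r; rewrite /= in_itv/= => /andP[r0 ry].
  apply: continuousB; last exact: cst_continuous.
  have cp : {for r, continuous (fun r : R => (x, 1 - r))}.
    apply: cont_pair; first exact: cst_continuous.
    by apply: continuousB; [exact: cst_continuous|exact: cont_id].
  apply: (@continuous_comp _ _ _ (fun r : R => k (x, 1 - r)) th).
    by apply: (@continuous_comp _ _ _ (fun r : R => (x, 1 - r)) k) => //; exact: lift_continuous.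
  by apply: th_cont; apply: nf; lra.
- move=> t /andP[t0 ty]; have xt : 1 - phi x <= 1 - t by lra.
  by have := cu _ xt => ? ?; lra.
- rewrite subr0 (lift_high k_lift)// th_high//= subrr; lra.
Qed.

Section triangle.
Variables (N tau : R) (C : R -> R * R).
Hypothesis C_cont : continuous C.
Hypothesis tau_gt1 : 1 < tau.
Hypothesis tauN : tau <= N.
Hypothesis C_push : forall t, 1 <= t <= N -> C t = push h phi (C (t - 1)).
Hypothesis C_simple : forall s t, 0 <= s -> s < t -> t <= N -> C s <> C t.
Hypothesis C_low : (C 0).2 <= 0.
Hypothesis C_left : forall t, 1 <= t <= N -> (C t).2 <= 0 -> (C t).1 < (C 0).1.
Hypothesis C_tau : (C tau).2 = 1.
Hypothesis C_before : forall s, 0 <= s < tau -> (C s).2 < 1.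

(** Pairs of parameters at distance at least [1]. The hypotenuse carries the
    displacements of the sheared map, the two legs the chords issued from the start and
    the chords arriving at the end of the arc. *)
Definition triangle := [set p : R * R | 0 <= p.1 /\ p.1 + 1 <= p.2 <= tau].

Definition chord (p : R * R) := C p.2 - C p.1.

Lemma chord_cont : continuous chord.
Proof.
have tN := tauN; have t1 := tau_gt1; have Cl := C_low.
move=> p; suff : {for p, continuous chord} by [].
apply: continuousB.
  by apply: (@continuous_comp _ _ _ (fun p : R * R => p.2) C); [exact: cvg_snd|exact: C_cont].
by apply: (@continuous_comp _ _ _ (fun p : R * R => p.1) C); [exact: cvg_fst|exact: C_cont].
Qed.

Lemma triangle_compact : compact triangle.
Proof.
have tN := tauN; have t1 := tau_gt1; have Cl := C_low.
have -> : triangle = ([set` `[0, tau]] `*` [set` `[0, tau]]) `&` [set p | 1 <= p.2 - p.1].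
  apply/seteqP; split=> -[s t]; rewrite /triangle /= !in_itv/=.
    move=> [s0 /andP[st tt]]; split; last lra.
    by split; apply/andP; split; lra.
  move=> [[/andP[? ?] /andP[? ?]] ?]; split=> //; apply/andP; split; lra.
apply: compact_closedI; first by apply: compact_setX; exact: segment_compact.
apply: (@closed_comp _ _ (fun p : R * R => p.2 - p.1) [set y | 1 <= y]); last exact: closed_ge.
by move=> p _; apply: continuousB; [exact: cvg_snd|exact: cvg_fst].
Qed.

Lemma triangle_star : star_at (0, tau) triangle.
Proof.
have tN := tauN; have t1 := tau_gt1; have Cl := C_low.
move=> [s t] l [/= s0 /andP[st tt]] /andP[l0 l1]; rewrite /seg; split=> /=; first nra.
by apply/andP; split; nra.
Qed.

Lemma chord_neq0 p : triangle p -> 0 < dot (chord p) (chord p).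
Proof.
have tN := tauN; have t1 := tau_gt1; have Cl := C_low.
rewrite /triangle /= => -[s0 /andP[st tt]];
  rewrite /dot -!expr2 lt_neqAle addr_ge0 ?sqr_ge0// andbT eq_sym.
rewrite paddr_eq0 ?sqr_ge0// !sqrf_eq0; apply/negP => /andP[/eqP e1 /eqP e2].
have p12 : p.1 < p.2 by lra.
have pN : p.2 <= N by exact: le_trans tt tauN.
apply: (C_simple s0 p12 pN); apply/esym/eqP; rewrite -subr_eq0; apply/eqP.
by move: e1 e2; rewrite -/(chord p); case: (chord p) => ? ? /= -> ->.
Qed.

Lemma chord_diag t : 0 <= t <= tau - 1 ->
  chord (t, t + 1) = ((disp h (C t)).1, (disp h (C t)).2 + phi (h (C t)).1).
Proof.
have tN := tauN; have t1 := tau_gt1; have Cl := C_low.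
move=> t01; rewrite /chord /= C_push; last by apply/andP; split; lra.
have -> : t + 1 - 1 = t by lra.
by rewrite /push /disp; case: (C t) => p q; congr (_, _) => /=; lra.
Qed.

Lemma arc_nonfixed t : 0 <= t <= tau - 1 -> h (C t) <> C t.
Proof.
have tN := tauN; have t1 := tau_gt1; have Cl := C_low.
move=> t01 e; have := @C_simple t (t + 1).
rewrite (@C_push (t + 1)); last by apply/andP; split; lra.
have -> : t + 1 - 1 = t by lra.
rewrite /push e (phi_fix e) addr0; case: (C t) => p q /=; apply=> //; lra.
Qed.

(** This is the argument of Hopf for the rotation of a tangent. The chord never vanishes
    on the triangle, so it turns equally along the hypotenuse and along the two legs. On
    the legs it never points straight down, hence it turns clockwise from a leftward to a
    rightward direction through the upward one. On the hypotenuse the chord is never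
    opposite to the displacement, so the displacement turns in the same way. *)
Lemma angle_drop_triangle : b < a.
Proof.
have tN := tauN; have t1 := tau_gt1; have Cl := C_low.
have pi0 := pi_gt0 R.
have [ca sa] := cos_sin_low; have [cb sb] := cos_sin_high.
have chord_end : 0 < (chord (0, tau)).2 by rewrite /chord /= C_tau; lra.
have [tc tc0 atc] := has_angle_upper chord_end.
have [al [alc cal aal]] :=
  compact_lift chord_cont triangle_compact triangle_star chord_neq0 atc.
have tri1 r : 0 <= r <= tau - 1 -> triangle (0, tau - r).
  by move=> ?; split=> /=; [lra|apply/andP; split; lra].
have tri2 r : 0 <= r <= tau - 1 -> triangle (r, tau).
  by move=> ?; split=> /=; [lra|apply/andP; split; lra].
have tri3 r : 0 <= r <= tau - 1 -> triangle (r, r + 1).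
  by move=> ?; split=> /=; [lra|apply/andP; split; lra].
have tau0 : 0 <= tau - 1 by lra.
have tau1 : 0 <= tau - 1 <= tau - 1 by rewrite tau0 lexx.
have tau2 : 0 <= (0 : R) <= tau - 1 by rewrite tau0 lexx.
(* Chords issued from the start: a later point straight below it would lie in the
   lower half-plane, hence strictly to its left. *)
have start : pi / 2 < al (0, 1) < 3 * pi / 2.
  have st : - pi < al (0, 1) - pi / 2 < pi.
    have -> : (0 : R, 1 : R) = (0, tau - (tau - 1)) by rewrite subKr.
    apply: (@cos_stay _ (fun r => al (0, tau - r) - pi / 2) 0 (tau - 1) tau0).
    - apply: cont_within => r; rewrite /= in_itv/= => r01.
      apply: continuousB; last exact: cst_continuous.
      apply: (@continuous_comp _ _ _ (fun r : R => (0, tau - r)) al).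
        apply: cont_pair; first exact: cst_continuous.
        by apply: continuousB; [exact: cst_continuous|exact: cont_id].
      by apply: cal; exact: tri1.
    - move=> r r01; rewrite cosBpihalf => sr.
      have [l l0 e] := aal _ (tri1 _ r01).
      have cr : cos (al (0, tau - r)) = 0 by apply: sin1cos0; rewrite sr normrN1.
      move: e; rewrite sr cr mulr0 mulrN1 /chord /=; case: (C _) (@C_left (tau - r)) => p q.
      case: (C 0) C_low => p0 q0 /= q00 h1 [e1 e2].
      have : p < p0 by apply: h1; [apply/andP; split; lra|lra].
      lra.
    - rewrite subr0 alc; lra.
  have : cos (al (0, 1)) < 0.
    have h01 : triangle (0, 1) by split=> /=; [lra|apply/andP; split; lra].
    rewrite (has_angle_cosN (aal _ h01)) /chord.
    have := chord_diag tau2; rewrite add0r /chord => ->.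
    by have [] := disp_low h_lift twist0 C_low.
  rewrite ltNge => /negP cn; move: st => /andP[st1 st2]; apply/andP; split; last lra.
  rewrite ltNge; apply/negP => le; apply: cn; apply: cos_ge0_pihalf.
  by apply/andP; split; lra.
(* Chords arriving at the end point upwards, as the end is higher than all earlier
   points. *)
have finish : - (pi / 2) < al (tau - 1, tau) < pi / 2.
  have sp r : 0 <= r <= tau - 1 -> 0 < sin (al (r, tau)).
    move=> r01; rewrite (has_angle_sin (aal _ (tri2 _ r01))) /chord /= C_tau subr_gt0.
    by apply: C_before; apply/andP; split; lra.
  have st : - pi < al (tau - 1, tau) - pi / 2 < pi.
    apply: (@cos_stay _ (fun r => al (r, tau) - pi / 2) 0 (tau - 1) tau0).
    - apply: cont_within => r; rewrite /= in_itv/= => r01.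
      apply: continuousB; last exact: cst_continuous.
      apply: (@continuous_comp _ _ _ (fun r : R => (r, tau)) al).
        by apply: cont_pair; [exact: cont_id|exact: cst_continuous].
      by apply: cal; exact: tri2.
    - by move=> r /sp; rewrite cosBpihalf => ? ?; lra.
    - rewrite alc; lra.
  have : - (pi / 2) < al (tau - 1, tau) - pi / 2 < pi / 2.
    by apply: cos_gt0_small => //; rewrite cosBpihalf; exact: sp.
  move=> st'; apply: cos_gt0_small; first by move: st' => /andP[? ?]; apply/andP; split; lra.
  rewrite (has_angle_cos (aal _ (tri2 _ tau1))) /chord /= C_push; last by apply/andP; split; lra.
  rewrite /push /= subr_gt0 -[X in X.1 < _]hK.
  case e : (h _) => [x y]; apply: phi_top.
  have := C_tau; rewrite C_push; last by apply/andP; split; lra.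
  rewrite /push e /=; lra.
(* Comparison with the displacement; the constant [a - pi] shifts the difference of the
   two angles to lie near 0 at the start, where both vectors point to the left. *)
have diag : - pi < al (tau - 1, tau) - th (C (tau - 1)) - pi + a < pi.
  have -> : (tau - 1, tau) = (tau - 1, tau - 1 + 1) by rewrite subrK.
  apply: (@cos_stay _ (fun r => al (r, r + 1) - th (C r) - pi + a) 0 (tau - 1) tau0).
  - apply: cont_within => r; rewrite /= in_itv/= => r01.
    apply: continuousD; last exact: cst_continuous.
    apply: continuousB; last exact: cst_continuous.
    apply: continuousB.
      apply: (@continuous_comp _ _ _ (fun r : R => (r, r + 1)) al).
        apply: cont_pair; first exact: cont_id.
        by apply: continuousD; [exact: cont_id|exact: cst_continuous].
      by apply: cal; exact: tri3.
    apply: (@continuous_comp _ _ _ C th); first exact: C_cont.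
    by apply: th_cont; exact: arc_nonfixed.
  - move=> r r01; rewrite cosD ca sa mulr0 subr0 mulrN1.
    have -> : al (r, r + 1) - th (C r) - pi = al (r, r + 1) - th (C r) + pi - pi *+ 2.
      by rewrite mulr2n; lra.
    rewrite -[cos (_ - _)](cosD2pi (_ - _)) subrK cosDpi opprK => e.
    have nf := arc_nonfixed r01.
    have [l l0] := has_angle_cosN1 (th_angle nf) (aal _ (tri3 _ r01)) e.
    rewrite chord_diag// => -[e1 e2].
    have d1 : (disp h (C r)).1 = 0.
      have : (1 + l) * (disp h (C r)).1 = 0 by rewrite mulrDl mul1r [X in X + _]e1 mulNr addNr.
      by move/eqP; rewrite mulf_eq0 gt_eqF ?addr_gt0//= => /eqP.
    have hC : (h (C r)).1 = (C r).1 by move: d1; rewrite /disp /=; lra.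
    have := phi_small nf hC; move: e2; rewrite hC /disp /=.
    have := phi_ge0 (C r).1; set d := _ - _ => p0 e2.
    have [d0|d0] := leP 0 d.
      by rewrite ger0_norm// => ?; have := mulr_ge0 (ltW l0) d0 => ?; lra.
    rewrite ltr0_norm// => ?; have := mulr_gt0 l0 (_ : 0 < - d).
    by rewrite oppr_gt0 => /(_ d0) ?; lra.
  - rewrite add0r th_low//; lra.
(* The end of the arc lies on the top line, so its predecessor is mapped just below it. *)
have near_top : - (pi / 2) < th (C (tau - 1)) - b < pi / 2.
  rewrite -[C _]hK; case e : (h _) => [x y]; apply: angle_near_top.
    have := C_tau; rewrite C_push; last by apply/andP; split; lra.
    rewrite /push e /=; lra.
  have := C_tau; rewrite C_push; last by apply/andP; split; lra.
  rewrite /push e /=; have := phi_ge0 x; lra.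
have ba : b - a < pi by lra.
rewrite ltNge; apply/negP => ab.
apply: (@cos_gtN1 _ (b - a)); first by apply/andP; split; lra.
by rewrite cosB ca cb sb mul0r addr0 mul1r.
Qed.

End triangle.

(** The arc is stopped when it first reaches the top of the annulus: then all earlier
    points are strictly lower, and the chords arriving at the end point upwards. *)
Lemma angle_drop (z0 : R * R) n : z0.2 <= 0 -> 1 <= (iter n (push h phi) z0).2 -> b < a.
Proof.
move=> z00 z0n.
have pc := push_cont h_lift phi_cont.
have c1 := first_arc1 phi h_lift z00.
have [C [Cc C1 Cp]] := flow_arc_exists pc (@first_arc_cont _ h _ phi_cont z0) c1 n.+1.
have Cit m : (m <= n)%N -> C m%:R = iter m (push h phi) z0.
  elim: m => [_|m IH mn]; first by rewrite C1// first_arc0.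
  rewrite iterS -IH ?(ltnW mn)// Cp; last first.
    by rewrite ler1n ler_nat (leq_trans mn).
  by rewrite -natr1 addrK.
have c2 : continuous (fun t => (C t).2).
  by move=> t; apply: (@cont_snd _ _ C); exact: Cc.
have C0 : C 0 = z0 by rewrite C1// first_arc0.
have [||tau [/andP[tau0 taun] Ctau Cb]] := first_time c2 (ler0n R n) (c := 1).
- by rewrite C0; lra.
- by rewrite Cit.
have taun1 : tau <= n.+1%:R by rewrite (le_trans taun)// ler_nat.
apply: (@angle_drop_triangle n.+1%:R tau C) => //.
- rewrite ltNge; apply/negP => t1; move: Ctau; rewrite C1// /first_arc /=.
  set x := z0.1 + _; have p1 := phi_lt1 x; have p0 := phi_ge0 x => e.
  by have := ler_piMl p0 t1 => ?; lra.
- exact: (arc_simple h_lift k_lift hK twist0 phi_ge0 z00 C1 Cp).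
- by rewrite C0.
- move=> t tn Ct; apply: (@le_lt_trans _ _ (h z0).1).
    apply: (arc_left h_lift k_lift hK twist0 phi_ge0 z00 C1 Cp) => //.
    exact: le_trans Ct (phi_ge0 _).
  by rewrite C0; exact: a1_lt.
Qed.

End angle_drop.

(** * The choice of the shear *)

Section cos_bump.
Variable R : realType.

Lemma cos_periodic_int (n : int) (x : R) : cos (x + pi *+ 2 * n%:~R) = cos x.
Proof.
have pos m (y : R) : cos (y + pi *+ 2 * m%:R) = cos y.
  by rewrite mulr_natr; exact: (periodicn (@cosD2pi R)).
case: n => m; first exact: pos.
by rewrite NegzE mulrNz mulrN -[LHS](pos m.+1) -pmulrn subrK.
Qed.

(** The profile is periodic, vanishes in a neighborhood of the orbit of [x0], so that
    the fixed points stay fixed, and is positive elsewhere on an open set, so that area is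
    really pushed upwards. *)
Definition cos_bump (x0 e x : R) := e * Num.max 0 (- cos (pi *+ 2 * (x - x0))).

Lemma bump_cont x0 e : continuous (cos_bump x0 e).
Proof.
move=> x; suff : {for x, continuous (cos_bump x0 e)} by [].
apply: continuousM; first exact: cst_continuous.
apply: cont_max; first exact: cst_continuous.
apply: continuousN.
apply: (@continuous_comp _ _ _ (fun x => pi *+ 2 * (x - x0)) (@cos R)); last exact: continuous_cos.
apply: continuousM; first exact: cst_continuous.
by apply: continuousB; [exact: cont_id|exact: cst_continuous].
Qed.

Lemma bump_ge0 x0 e x : 0 <= e -> 0 <= cos_bump x0 e x.
Proof. by move=> e0; rewrite mulr_ge0// le_max lexx. Qed.

Lemma bump_le x0 e x : 0 <= e -> cos_bump x0 e x <= e.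
Proof.
by move=> e0; rewrite ler_piMr// ge_max ler01/= lerNl; exact: cos_geN1.
Qed.

Lemma bump_shift x0 e x (n : int) : cos_bump x0 e (x + n%:~R) = cos_bump x0 e x.
Proof. by rewrite /cos_bump addrAC mulrDr cos_periodic_int. Qed.

Lemma bump_opp x0 e x : cos_bump (- x0) e (- x) = cos_bump x0 e x.
Proof. by rewrite /cos_bump -opprD mulrN cosN. Qed.

Lemma bump_int x0 e (n : int) : cos_bump x0 e (x0 + n%:~R) = 0.
Proof.
rewrite bump_shift /cos_bump subrr mulr0 cos0 max_l ?mulr0//; lra.
Qed.

Lemma bump_gt0_cos x0 e x : cos_bump x0 e x != 0 -> cos (pi *+ 2 * (x - x0)) < 0.
Proof.
rewrite ltNge; apply: contra => c0; rewrite /cos_bump max_l ?mulr0//.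
by rewrite oppr_le0.
Qed.

Lemma frac_shift (a x : R) : exists n : int, a <= x + n%:~R <= a + 1.
Proof.
exists (- Num.floor (x - a)); rewrite mulrNz.
have := floor_itv (x - a); rewrite intrD1 => /andP[? ?].
by apply/andP; split; lra.
Qed.

End cos_bump.

Section index.
Variables (R : realType) (h k : R * R -> R * R) (x0 y0 : R).
Hypothesis h_lift : plane_lift h.
Hypothesis k_lift : plane_lift k.
Hypothesis hK : cancel h k.
Hypothesis kK : cancel k h.
Hypothesis twist0 : forall x, (h (x, 0)).1 < x.
Hypothesis twist1 : forall x, x < (h (x, 1)).1.
Hypothesis h_fix : forall z, h z = z -> z.2 = y0 /\ exists n : int, z.1 = x0 + n%:~R.

Lemma inverse_twist1 x : (k (x, 1)).1 < x.
Proof.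
have := twist1 (k (x, 1)).1; rewrite (_ : ((k (x, 1)).1, 1) = k (x, 1)) ?kK//.
by rewrite [RHS](lift_high k_lift).
Qed.

Lemma inverse_twist0 x : x < (k (x, 0)).1.
Proof.
have := twist0 (k (x, 0)).1; rewrite (_ : ((k (x, 0)).1, 0) = k (x, 0)) ?kK//.
by rewrite [RHS](lift_low k_lift).
Qed.

(** Where the profile is positive, the displacement is bounded away from zero. A shear of
    smaller amplitude then neither creates fixed points nor reverses the displacement. *)
Lemma bump_small : exists2 m, 0 < m & forall e, 0 < e -> e < m ->
  forall z, h z <> z -> (h z).1 = z.1 -> cos_bump x0 e z.1 < `|(h z).2 - z.2|.
Proof.
(* The cosine is 1 at the fixed points and negative wherever the profile is positive. *)
pose g (z : R * R) := Num.max (dot (disp h z) (disp h z)) (cos (pi *+ 2 * (z.1 - x0))).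
have cg : continuous g.
  move=> z; suff : {for z, continuous g} by [].
  apply: cont_max; first by apply: cont_dot; apply: disp_continuous; exact: lift_continuous.
  apply: (@continuous_comp _ _ _ (fun z : R * R => pi *+ 2 * (z.1 - x0)) (@cos R));
    last exact: continuous_cos.
  apply: continuousM; first exact: cst_continuous.
  by apply: continuousB; [exact: cvg_fst|exact: cst_continuous].
have [||m m0 mP] := @compact_pos_lbound R _ ([set` `[x0, x0 + 1]] `*` [set` `[0, 1 : R]]) g _ cg.
- by apply: compact_setX; exact: segment_compact.
- move=> z _; rewrite /g lt_max; have [hz|nz] := pselect (h z = z); last by rewrite disp_dot_gt0.
  have [_ [n ->]] := h_fix hz.
  by rewrite addrAC subrr mulrDr cos_periodic_int mulr0 cos0 ltr01 orbT.
exists (Num.min 1 m); first by rewrite lt_min ltr01.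
move=> e e0; rewrite lt_min => /andP[e1 em] z nz h1.
have d1 : (disp h z).1 = 0 by rewrite /disp /= h1 subrr.
have d2 : 0 < `|(h z).2 - z.2|.
  rewrite normr_gt0 subr_eq0; apply/eqP => h2; apply: nz.
  by move: h1 h2; case: (h z); case: z {d1} => ? ? ? ? /= -> ->.
have [->//|bn0] := eqVneq (cos_bump x0 e z.1) 0.
have cn := bump_gt0_cos bn0.
have [zl|zl] := leP z.2 0; first by have [] := disp_low h_lift twist0 zl; rewrite d1 ltxx.
have [zh|zh] := leP 1 z.2; first by have [] := disp_high h_lift twist1 zh; rewrite d1 ltxx.
have [n xn] := frac_shift x0 z.1.
have : m <= g (z.1 + n%:~R, z.2).
  by apply: mP; split; rewrite /= in_itv/= ?xn// !ltW.
rewrite /g disp_shift_int//= addrAC mulrDr cos_periodic_int le_max => /orP[|mc]; last first.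
  by move: (lt_le_trans m0 mc); rewrite ltNge (ltW cn).
rewrite /dot d1 mul0r add0r /disp /= -expr2 => md.
apply: (le_lt_trans (bump_le x0 z.1 (ltW e0))).
rewrite -(@ltr_pXn2r _ 2) ?nnegrE ?(ltW e0) ?(ltW d2)//.
rewrite real_normK ?num_real//; apply: lt_le_trans md.
by apply: lt_trans em; rewrite expr2 gtr_pMl.
Qed.

(** Just below the upper boundary the inverse still moves points to the left. *)
Lemma bump_top : exists2 m, 0 < m & forall e, 0 < e -> e < m ->
  forall x y, 1 - cos_bump x0 e x <= y -> (k (x, y)).1 < x.
Proof.
(* Within the lower bound of [g] from the top, the first term must be the large one. *)
pose g (z : R * R) := Num.max (z.1 - (k z).1) (1 - z.2).
have cg : continuous g.
  move=> z; suff : {for z, continuous g} by [].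
  apply: cont_max; apply: continuousB.
  - exact: cvg_fst.
  - by apply: cont_fst; exact: (lift_continuous k_lift).
  - exact: cst_continuous.
  - exact: cvg_snd.
have [||m m0 mP] := @compact_pos_lbound R _ ([set` `[0, 1 : R]] `*` [set` `[0, 1 : R]]) g _ cg.
- by apply: compact_setX; exact: segment_compact.
- move=> [x y] [/= _]; rewrite in_itv/= => /andP[y0' y1]; rewrite /g lt_max/= !subr_gt0.
  have [->|ne] := eqVneq y 1; first by rewrite inverse_twist1.
  by rewrite orbC lt_neqAle ne y1.
exists (Num.min 1 m); first by rewrite lt_min ltr01.
move=> e e0; rewrite lt_min => /andP[e1 em] x y xy.
have [y1|y1] := leP 1 y; first by rewrite (lift_high k_lift)//; exact: inverse_twist1.
have be := bump_le x0 x (ltW e0).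
have [n xn] := frac_shift 0 x; rewrite add0r in xn.
have := mP (x + n%:~R, y); rewrite /g (lift_shift_int n (x, y) k_lift)/=.
rewrite !in_itv/= xn le_max => mle.
have : (m <= x + n%:~R - ((k (x, y)).1 + n%:~R)) || (m <= 1 - y).
  by apply: mle; split=> //; apply/andP; split; lra.
case/orP => ?; lra.
Qed.

Lemma index_lt (th : R * R -> R) (a b : R) :
  (forall z, h z <> z -> has_angle (disp h z) (th z)) ->
  (forall z, h z <> z -> {for z, continuous th}) ->
  (forall z, z.2 <= 0 -> th z = a) -> (forall z, 1 <= z.2 -> th z = b) ->
  (forall e, 0 < e -> exists z n, z.2 <= 0 /\ 1 <= (iter n (push h (cos_bump x0 e)) z).2) ->
  b < a.
Proof.
move=> ath cth th0 th1 esc.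
have [m1 m10 P1] := bump_small; have [m2 m20 P2] := bump_top.
pose e := Num.min (2^-1) (Num.min (m1 / 2) (m2 / 2)).
have e0 : 0 < e by rewrite !lt_min; apply/and3P; split; lra.
have el : e <= 2^-1 by rewrite ge_min lexx.
have e1 : e <= m1 / 2 by rewrite !ge_min lexx orbT.
have e2 : e <= m2 / 2 by rewrite !ge_min lexx !orbT.
have [z [n [z0 zn]]] := esc e e0.
apply: (angle_drop h_lift k_lift hK kK twist0 twist1
  (@bump_cont _ x0 e) _ _ _ _ _ ath cth th0 th1 z0 zn).
- by move=> x; apply: bump_ge0; exact: ltW.
- by move=> x; have := bump_le x0 x (ltW e0) => ?; lra.
- by move=> w /h_fix[_ [i ->]]; exact: bump_int.
- by apply: P1 => //; lra.
- by apply: P2 => //; lra.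
Qed.

End index.

(** * The mirror image of the inverse *)

Section mirror.
Variables (R : realType) (h k : R * R -> R * R) (x0 y0 : R).
Hypothesis h_lift : plane_lift h.
Hypothesis k_lift : plane_lift k.
Hypothesis hK : cancel h k.
Hypothesis kK : cancel k h.
Hypothesis twist0 : forall x, (h (x, 0)).1 < x.
Hypothesis twist1 : forall x, x < (h (x, 1)).1.
Hypothesis h_fix : forall z, h z = z -> z.2 = y0 /\ exists n : int, z.1 = x0 + n%:~R.

Definition mirror (z : R * R) := (- z.1, z.2).
Definition mirrored (g : R * R -> R * R) z := mirror (g (mirror z)).

Lemma mirrorK : involutive mirror.
Proof. by case=> x y; rewrite /mirror /= opprK. Qed.

Lemma mirror_cont : continuous mirror.
Proof.
move=> z; suff : {for z, continuous mirror} by [].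
by apply: cont_pair; [apply: continuousN; exact: cvg_fst|exact: cvg_snd].
Qed.

Lemma mirrored_cancel g1 g2 : cancel g1 g2 -> cancel (mirrored g1) (mirrored g2).
Proof. by move=> gK z; rewrite /mirrored mirrorK gK mirrorK. Qed.

Lemma mirrored_lift g : plane_lift g -> plane_lift (mirrored g).
Proof.
move=> gl; split.
- move=> z; apply: (@continuous_comp _ _ _ (fun z => g (mirror z)) mirror); last exact: mirror_cont.
  by apply: (@continuous_comp _ _ _ mirror g); [exact: mirror_cont|exact: lift_continuous].
- move=> z; rewrite /mirrored /mirror /=.
  have := lift_shift_int (-1) (mirror z) gl; rewrite mulrNz mulr1z /= opprD => -> /=.
  by rewrite opprB addrC.
- by move=> x y yl; rewrite /mirrored /mirror /= (lift_low gl).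
- by move=> x y yl; rewrite /mirrored /mirror /= (lift_high gl).
Qed.

Lemma mirrored_push g e z : push (mirrored g) (cos_bump (- x0) e) (mirror z) =
  mirror (push g (cos_bump x0 e) z).
Proof. by rewrite /push /mirrored mirrorK /mirror /= bump_opp. Qed.

(** The inverse, seen in a mirror, is again a twist map with the same direction of twist.
    As the displacement of the inverse is opposite to that of the map, the angles of the
    mirrored inverse are the negatives of those of the map. The strict inequality between
    the lower and the upper angle would hold for both. *)
Lemma no_double_escape :
  (forall e, 0 < e -> exists z n, z.2 <= 0 /\ 1 <= (iter n (push h (cos_bump x0 e)) z).2) ->
  (forall e, 0 < e -> exists z n, z.2 <= 0 /\ 1 <= (iter n (push k (cos_bump x0 e)) z).2) ->
  False.
Proof.
move=> esc_h esc_k.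
have [th [a [b [ath cth th0 th1]]]] := global_angle h_lift twist0 twist1 h_fix.
have ba := index_lt h_lift k_lift hK kK twist0 twist1 h_fix ath cth th0 th1 esc_h.
suff : - b < - a by lra.
have nf z : mirrored k z <> z -> h (k (mirror z)) <> k (mirror z).
  rewrite kK => kz e; apply: kz; rewrite /mirrored -e; exact: mirrorK.
have kl z : z.2 <= 0 -> (k (mirror z)).2 <= 0.
  by move=> zl; rewrite (lift_lowE k_lift).
have kh z : 1 <= z.2 -> 1 <= (k (mirror z)).2.
  by case: z => x y /= zl; rewrite (lift_high k_lift).
apply: (@index_lt _ (mirrored k) (mirrored h) (- x0) y0 _ _ _ _ _ _ _
  (fun z => - th (k (mirror z)))).
- exact: mirrored_lift.
- exact: mirrored_lift.
- exact: mirrored_cancel.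
- exact: mirrored_cancel.
- by move=> x; rewrite /mirrored /mirror /= ltrNl; exact: (inverse_twist0 k_lift kK twist0).
- by move=> x; rewrite /mirrored /mirror /= ltrNr; exact: (inverse_twist1 k_lift kK twist1).
- move=> z e; have hz : h (mirror z) = mirror z.
    by rewrite -[in LHS]e /mirrored mirrorK kK.
  have [z2 [n zn]] := h_fix hz; split=> //; exists (- n); rewrite mulrNz.
  by move: zn; rewrite /mirror /=; lra.
- move=> z /nf/ath[r r0 e]; exists r => //; move: e; rewrite /disp kK /mirrored /mirror /=.
  rewrite cosN sinN mulrN => -[<- <-]; congr (_, _); lra.
- move=> z /nf kz; apply: continuousN.
  apply: (@continuous_comp _ _ _ (fun z => k (mirror z)) th); last exact: cth.
  by apply: (@continuous_comp _ _ _ mirror k); [exact: mirror_cont|exact: lift_continuous].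
- by move=> z /kl/th0 ->.
- by move=> z /kh/th1 ->.
move=> e e0; have [z [n [zl zn]]] := esc_k e e0; exists (mirror z), n; split=> //.
have -> : iter n (push (mirrored k) (cos_bump (- x0) e)) (mirror z) =
    mirror (iter n (push k (cos_bump x0 e)) z); last exact: zn.
by elim: n {zn} => //= n ->; rewrite mirrored_push.
Qed.

End mirror.

(** * Area in the universal cover *)

Section plane_measure.
Variable R : realType.
Local Notation Rm := (measurableTypeR R).
Local Notation lam := (@lebesgue_measure R).

Lemma lebesgue_measure_shift (c : R) (B : set Rm) : measurable B ->
  lam ((fun y : Rm => (y + c : Rm)) @^-1` B) = lam B.
Proof.
move=> mB; have mf : measurable_fun [set: Rm] (fun y : Rm => (y + c : Rm)).
  by apply: measurable_realfun.measurable_funD.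
pose F : {mfun Rm >-> Rm} := HB.pack (fun y : Rm => (y + c : Rm))
  (isMeasurableFun.Build _ _ _ _ _ mf).
apply/esym; apply: (@lebesgue_measure_unique R (pushforward lam F)) => //= _ [[a b]] _ <-.
rewrite /pushforward.
have -> : F @^-1` `]a, b] = `](a - c), (b - c)]%classic :> set R.
  by apply/seteqP; split=> y /=; rewrite !in_itv/= => /andP[? ?]; apply/andP; split; lra.
rewrite !lebesgue_measure_itv/= !lte_fin ltrD2r.
by case: ifP => // _; rewrite -!EFinB; congr EFin; lra.
Qed.

Definition rat_box (q : rat * rat * rat) : set (Rm * Rm) :=
  [set` `](ratr q.1.1 - ratr q.2 : R), ratr q.1.1 + ratr q.2[] `*`
  [set` `](ratr q.1.2 - ratr q.2 : R), ratr q.1.2 + ratr q.2[].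

(** The product sigma-algebra contains the countably many rational boxes, and every open
    set is the union of those that it contains. *)
Lemma open_measurable2 (U : set (R * R)) : open U -> measurable (U : set (Rm * Rm)).
Proof.
move=> oU; pose F q := [set z | rat_box q `<=` U /\ rat_box q z].
have -> : U = \bigcup_q F q.
  apply/seteqP; split=> [z Uz|z [q _ [qU]]]; last exact: qU.
  have /nbhs_ballP[e /= e0 eU] := open_nbhs_nbhs (conj oU Uz).
  have e2 : 0 < e / 2 by lra.
  have [r] := rat_in_itvoo e2; rewrite in_itv/= => /andP[r0 re].
  have [a] : exists a : rat, ratr a \in `](z.1 - ratr r), (z.1 + ratr r)[.
    by apply: rat_in_itvoo; lra.
  rewrite in_itv/= => /andP[a1 a2].
  have [b] : exists b : rat, ratr b \in `](z.2 - ratr r), (z.2 + ratr r)[.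
    by apply: rat_in_itvoo; lra.
  rewrite in_itv/= => /andP[b1 b2].
  exists (a, b, r) => //; split=> [[x y]|]; rewrite /rat_box /= !in_itv/=; last first.
    by split; apply/andP; split; lra.
  move=> [/andP[? ?] /andP[? ?]]; apply: eU.
  by split; rewrite /ball /= ltr_norml; apply/andP; split; lra.
apply: countable_bigcupT_measurable => // q.
have [qU|nqU] := pselect (rat_box q `<=` U).
  have -> : F q = rat_box q by apply/seteqP; split=> z; [case|split].
  by apply: measurableX; exact: measurable_itv.
by have -> : F q = set0; [apply/seteqP; split=> z // -[]|exact: measurable0].
Qed.

Local Notation area2 := (lam \x lam)%E.

Definition base_strip : set (Rm * Rm) := [set` `[0, 1[] `*` setT.
Definition base_square : set (Rm * Rm) := [set` `[0, 1[] `*` [set` `[0, 1]].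

Lemma measurable_base_strip : measurable base_strip.
Proof. by apply: measurableX => //; exact: measurable_itv. Qed.

Lemma measurable_base_square : measurable base_square.
Proof. by apply: measurableX => //; exact: measurable_itv. Qed.

Lemma area2_base_square : (area2 base_square < +oo)%E.
Proof.
rewrite /base_square product_measure1E; [|exact: measurable_itv..].
rewrite /= (lebesgue_measure_itv `[0, 1[) (lebesgue_measure_itv `[0, 1])/= !lte_fin ltr01.
by rewrite -!EFinB -EFinM ltry.
Qed.

(** Fubini: a vertical shear translates each vertical section. *)
Lemma area2_shear (phi : R -> R) (A : set (Rm * Rm)) : measurable A ->
  area2 (base_strip `&` (fun z => (z.1, z.2 + phi z.1)) @^-1` A) = area2 (base_strip `&` A).
Proof.
move=> mA; rewrite /product_measure1; apply: eq_integral => x _ /=.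
have mS : measurable (xsection (base_strip `&` A) x).
  by apply: measurable_xsection; apply: measurableI => //; exact: measurable_base_strip.
by rewrite -(lebesgue_measure_shift (phi x) mS).
Qed.

Lemma area2_periodic_open_gt0 (U : set (R * R)) (z : R * R) : open U -> U z ->
  (forall (n : int) z, U z -> U (z.1 + n%:~R, z.2)) ->
  (0 < area2 (base_strip `&` U))%E.
Proof.
move=> oU Uz pU.
have [w Uw /andP[w0 w1]] : exists2 w, U w & 0 <= w.1 < 1.
  exists (z.1 + (- Num.floor z.1)%:~R, z.2); first exact: pU.
  by have := floor_itv z.1; rewrite /= mulrNz intrD1 => /andP[? ?]; apply/andP; split; lra.
have /nbhs_ballP[e /= e0 eU] := open_nbhs_nbhs (conj oU Uw).
pose b := Num.min 1 (w.1 + e).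
have wb : w.1 < b by rewrite lt_min w1 ltrDl.
have b1 : b <= 1 by rewrite ge_min lexx.
have be : b <= w.1 + e by rewrite ge_min lexx orbT.
pose B : set (Rm * Rm) := [set` `]w.1, b[] `*` [set` `](w.2 - e), (w.2 + e)[].
have mB : measurable B by apply: measurableX; exact: measurable_itv.
have BU : B `<=` base_strip `&` U.
  move=> [x y]; rewrite /B /= !in_itv/= => -[/andP[x1 x2] /andP[y1 y2]]; split.
    by split=> //=; rewrite in_itv/=; apply/andP; split; lra.
  by apply: eU; split; rewrite /ball /= ltr_norml; apply/andP; split; lra.
apply: (@lt_le_trans _ _ (area2 B)); last first.
  apply: le_measure => //; rewrite inE//.
  by apply: measurableI; [exact: measurable_base_strip|exact: open_measurable2].
rewrite /B product_measure1E; [|exact: measurable_itv..].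
rewrite /= (lebesgue_measure_itv `]w.1, b[) (lebesgue_measure_itv `](w.2 - e), (w.2 + e)[)/=.
rewrite !lte_fin wb ifT; last lra.
by rewrite -!EFinB -EFinM lte_fin mulr_gt0//; lra.
Qed.

End plane_measure.

(** * Area preservation forces an orbit to climb *)

Section escape.
Variables (R : realType) (h k : R * R -> R * R) (x0 e : R).
Local Notation Rm := (measurableTypeR R).
Local Notation area2 := (@lebesgue_measure R \x @lebesgue_measure R)%E.
Hypothesis h_lift : plane_lift h.
Hypothesis k_lift : plane_lift k.
Hypothesis hK : cancel h k.
Hypothesis kK : cancel k h.
Hypothesis e_gt0 : 0 < e.

Definition periodic_set (U : set (R * R)) :=
  forall (n : int) z, U z <-> U (z.1 + n%:~R, z.2).

(** For a periodic set inside the open strip, the fundamental square stands for the whole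
    annulus. *)
Definition area_invariant (g : R * R -> R * R) := forall U : set (R * R), open U ->
  periodic_set U -> (forall z, U z -> 0 < z.2 < 1) ->
  area2 (@base_square R `&` g @^-1` U) = area2 (@base_square R `&` U).

Hypothesis h_area : area_invariant h.

Let phi := cos_bump x0 e.
Let P := push h phi.
Let phi0 x : 0 <= phi x. Proof. by apply: bump_ge0; exact: ltW. Qed.
Let lift_phi (z : R * R) : R * R := (z.1, z.2 + phi z.1).

Definition pull (z : R * R) := k (z.1, z.2 - cos_bump x0 e z.1).

Lemma push_pull z : P (pull z) = z.
Proof. by rewrite /P /push /pull kK /= subrK; case: z. Qed.

Lemma pull_push z : pull (P z) = z.
Proof. by rewrite /P /push /pull /= addrK -[RHS]hK; case: (h z). Qed.

Lemma pull_cont : continuous pull.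
Proof.
move=> z; apply: (@continuous_comp _ _ _ (fun z => (z.1, z.2 - cos_bump x0 e z.1)) k);
  last exact: (lift_continuous k_lift).
apply: cont_pair; first exact: cvg_fst.
apply: continuousB; first exact: cvg_snd.
by apply: (@continuous_comp _ _ _ (fun z : R * R => z.1) (cos_bump x0 e));
  [exact: cvg_fst|exact: bump_cont].
Qed.

Lemma pull_shift (n : int) z : pull (z.1 + n%:~R, z.2) = ((pull z).1 + n%:~R, (pull z).2).
Proof. by rewrite /pull /= bump_shift (lift_shift_int n (_, _) k_lift). Qed.

Lemma iter_pull_shift m (n : int) z :
  iter m pull (z.1 + n%:~R, z.2) = ((iter m pull z).1 + n%:~R, (iter m pull z).2).
Proof. by elim: m => //= m ->; rewrite pull_shift. Qed.

(** Described through the past of a point, so that the set is open by the continuity of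
    the inverse. *)
Definition swept := [set z : R * R | 0 < z.2 /\ exists n, (iter n pull z).2 < 0].

Lemma iter_pull_cont n : continuous (iter n pull).
Proof.
elim: n => [|n IH] z; first exact: cvg_id.
by apply: (@continuous_comp _ _ _ (iter n pull) pull); [exact: IH|exact: pull_cont].
Qed.

Lemma swept_open : open swept.
Proof.
have -> : swept = [set z | 0 < z.2] `&` \bigcup_n [set z | (iter n pull z).2 < 0].
  by apply/seteqP; split=> [z [? [n ?]]|z [? [n _ ?]]]; split=> //; exists n.
apply: openI; first by apply: (open_comp _ (@open_gt R 0)) => z _; exact: cvg_snd.
apply: bigcup_open => n _; apply: (open_comp _ (@open_lt R 0)) => z _.
by apply: (@cont_snd _ _ (iter n pull)); exact: iter_pull_cont.
Qed.

Lemma swept_periodic : periodic_set swept.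
Proof.
move=> n z; split=> -[z0 [m zm]]; split=> //; exists m; first by rewrite iter_pull_shift.
by rewrite iter_pull_shift in zm.
Qed.

Lemma high_image z : (0 < (h z).2) = (0 < z.2).
Proof.
apply/idP/idP; rewrite !ltNge; apply: contra.
  by move=> zl; rewrite (lift_lowE h_lift zl).
exact: (low_of_low_image k_lift hK).
Qed.

(** Going back one step, a point of the strip keeps the property of having a negative
    ordinate somewhere in its past. *)
Lemma swept_push z : 0 < z.2 -> swept (P z) <-> swept z.
Proof.
move=> z0; split=> -[Pz0 [n zn]]; split=> //.
- case: n zn => [zn|n]; first by move: zn Pz0 => /=; lra.
  by rewrite iterSr pull_push => ?; exists n.
- by rewrite /P /push /= ltr_pwDl// high_image.
- by exists n.+1; rewrite iterSr pull_push.
Qed.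

(** If no orbit climbed across the annulus, the region swept from below would be an open
    subset of it. Its preimage under the shear has the same area and consists of a part
    below the bottom line and of the image of the region under the map, which again has
    the same area. So the part below would have area zero; but it contains a nonempty open
    set, since the shear lifts points across the bottom line. *)
Lemma escape_exists : exists z n, z.2 <= 0 /\ 1 <= (iter n (push h (cos_bump x0 e)) z).2.
Proof.
apply: contrapT => noesc; have e0 := e_gt0.
have below z : swept z -> z.2 < 1.
  move=> [_ [n zn]]; rewrite ltNge; apply/negP => z1; apply: noesc.
  exists (iter n pull z), n; split; first exact: ltW.
  suff -> : iter n P (iter n pull z) = z by [].
  by elim: n {zn} z {z1} => // n IH z; rewrite iterS iterSr IH push_pull.
pose A := lift_phi @^-1` swept.
have cl : continuous lift_phi.
  move=> z; suff : {for z, continuous lift_phi} by [].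
  apply: cont_pair; first exact: cvg_fst.
  apply: continuousD; first exact: cvg_snd.
  by apply: (@continuous_comp _ _ _ (fun z : R * R => z.1) phi); [exact: cvg_fst|exact: bump_cont].
have oA : open A by apply: (open_comp _ swept_open) => z _; exact: cl.
have pA : periodic_set A.
  move=> n z; rewrite /A /preimage /= /lift_phi /= /phi bump_shift.
  exact: (swept_periodic n (z.1, _)).
pose A1 := A `&` [set z | 0 < z.2]; pose A2 := A `&` [set z | z.2 < 0].
have o1 : open A1.
  by apply: openI => //; apply: (open_comp _ (@open_gt R 0)) => z _; exact: cvg_snd.
have o2 : open A2.
  by apply: openI => //; apply: (open_comp _ (@open_lt R 0)) => z _; exact: cvg_snd.
have p1 : periodic_set A1.
  by move=> n z; split=> -[Az z0]; split=> //; [rewrite -pA|rewrite (pA n)].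
have b1 z : A1 z -> 0 < z.2 < 1.
  move=> [/below + z0]; rewrite z0 /lift_phi /= => z1.
  by have := phi0 z.1; lra.
have hA1 : h @^-1` A1 = swept.
  apply/seteqP; split=> z.
    by rewrite /A1 /= => -[Az]; rewrite high_image => /swept_push <-.
  move=> sz; have z0 : 0 < z.2 by case: sz.
  by split; rewrite /= ?high_image//; exact/swept_push.
have := h_area o1 p1 b1; rewrite hA1 => areaE.
have sq (B : set (R * R)) : (forall z, B z -> 0 < z.2 < 1) ->
    @base_square R `&` B = @base_strip R `&` B.
  move=> hB; apply/seteqP; split=> z [[z1 z2] Bz]; split=> //; split=> //.
  by have /andP[? ?] := hB _ Bz; rewrite /= in_itv/= !ltW.
have bsw z : swept z -> 0 < z.2 < 1 by move=> sz; rewrite below//; case: sz => ->.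
have m1 := open_measurable2 o1; have m2 := open_measurable2 o2.
have ms := @measurable_base_strip R; have msq := @measurable_base_square R.
have shear := area2_shear phi (open_measurable2 swept_open).
have A2z : A2 (x0 + 2^-1, - (e / 2)).
  have b0 : phi (x0 + 2^-1) = e.
    rewrite /phi /cos_bump; have -> : pi *+ 2 * (x0 + 2^-1 - x0) = pi by rewrite mulr2n; lra.
    by rewrite cospi opprK max_r// mulr1.
  split=> /=; last lra.
  rewrite /A /preimage /= /lift_phi /= b0; split=> /=; first lra.
  exists 1%N; rewrite /= /pull /= -/phi b0 (lift_low k_lift)/=; lra.
have A2p (n : int) z : A2 z -> A2 (z.1 + n%:~R, z.2).
  by move=> [Az z0]; split=> //; rewrite -pA.
have pos := area2_periodic_open_gt0 o2 A2z A2p.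
have fin : (area2 (@base_strip R `&` A1) < +oo)%E.
  rewrite -sq//; apply: le_lt_trans (@area2_base_square R).
  by apply: le_measure; rewrite ?inE//; exact: measurableI.
have : (area2 (@base_strip R `&` A1) + area2 (@base_strip R `&` A2) <=
        area2 (@base_strip R `&` A1))%E.
  rewrite -[in leRHS](sq _ b1) -areaE (sq _ bsw) -shear -measureU; first last.
  - apply/seteqP; split=> // z [[_ [_ /= z0]] [_ [_ /= z1]]]; lra.
  - exact: measurableI.
  - exact: measurableI.
  apply: le_measure; rewrite ?inE.
  - by apply: measurableU; exact: measurableI.
  - by apply: measurableI => //; exact: open_measurable2.
  - by move=> z [[? []]|[? []]].
apply/negP; rewrite -ltNge.
rewrite -[X in (X < _)%E]adde0 lteD2lE//.
by rewrite ge0_fin_numE.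
Qed.

End escape.

(** * Inverses of lifts *)

Section inverse.
Variables (R : realType) (h k : R * R -> R * R).
Hypothesis h_lift : plane_lift h.

Lemma boundary_surj (y : R) : y <= 0 \/ 1 <= y -> forall x, exists x', h (x', y) = (x, y).
Proof.
move=> hy x; have hE t : h (t, y) = ((h (t, y)).1, y).
  by case: hy => hy; rewrite ?(lift_low h_lift t hy) ?(lift_high h_lift t hy).
pose g t := (h (t, y)).1; suff [t gt] : exists t, g t = x.
  by exists t; rewrite hE -/(g t) gt.
have cg : continuous g.
  move=> t; apply: (@cont_fst _ _ (fun t : R => h (t, y))).
  apply: (@continuous_comp _ _ _ (fun t : R => (t, y)) h); last exact: (lift_continuous h_lift).
  exact: (cont_pair (@cont_id _ t) (@cst_continuous _ _ _ _)).
have gn (n : int) : g n%:~R = g 0 + n%:~R.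
  by rewrite /g -[n%:~R in LHS]add0r (lift_shift_int n (0, y) h_lift).
pose n := Num.bound `|x - g 0|.
have : `|x - g 0| < n%:R by apply: archi_boundP.
rewrite ltr_norml => /andP[n1 n2].
have [||t _ gt] := @IVT R g ((- n%:Z)%:~R) (n%:Z%:~R) x _ (continuous_subspaceT cg).
- by rewrite mulrNz -pmulrn; have : (0 : R) <= n%:R by []; lra.
- by rewrite !gn mulrNz -pmulrn ge_min le_max; apply/andP; split; apply/orP; [left|right]; lra.
by exists t.
Qed.

Hypothesis hK : cancel h k.
Hypothesis kK : cancel k h.

Lemma disp_bounded : exists M : R, forall z, `|h z - z| <= M.
Proof.
have cn : continuous (fun z : R * R => `|h z - z|).
  move=> z; apply: (@continuous_comp _ _ _ (fun z : R * R => h z - z) (fun v : R * R => `|v|)).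
    by apply: continuousB; [exact: (lift_continuous h_lift)|exact: cont_id].
  exact: norm_continuous.
have cB : compact ([set` `[0, 1 : R]] `*` [set` `[0, 1 : R]]).
  by apply: compact_setX; exact: segment_compact.
have [|c _ cmax] := @compact_EVT_max _ R _ _ _ cB (continuous_subspaceT cn).
  by exists (0, 0); split=> /=; rewrite in_itv/= lexx ler01.
exists `|h c - c| => z.
have [n zn] := frac_shift 0 z.1; rewrite add0r in zn.
have dispE (w : R * R) : h w - w = disp h w by [].
have low x y : y <= 0 -> h (x, y) - (x, y) = h (x, 0) - (x, 0).
  by move=> yl; rewrite !dispE /disp (lift_low h_lift x yl) (lift_low h_lift x (lexx 0))/= !subrr.
have high x y : 1 <= y -> h (x, y) - (x, y) = h (x, 1) - (x, 1).
  by move=> yl; rewrite !dispE /disp (lift_high h_lift x yl) (lift_high h_lift x (lexx 1))/= !subrr.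
rewrite dispE -(disp_shift_int n z h_lift) -dispE.
have box y : 0 <= y <= 1 -> `|h (z.1 + n%:~R, y) - (z.1 + n%:~R, y)| <= `|h c - c|.
  by move=> y01; apply: cmax; apply/mem_set; split; rewrite /= in_itv/=.
have [zl|zl] := leP z.2 0; first by rewrite low// box// lexx ler01.
have [zh|zh] := leP 1 z.2; first by rewrite high// box// lexx ler01.
by rewrite box// !ltW.
Qed.

(** The map moves points by a bounded amount, so the preimages of nearby points stay in
    a compact box, on which a continuous injective map is a homeomorphism. *)
Lemma inverse_continuous : continuous k.
Proof.
have [M hM] := disp_bounded; move=> w; apply/cvgrPdist_lt => e e0.
pose box (a : R) := [set` `[a - (M + 1), a + (M + 1)]].
(* Where [h z] is closer to [w] than the lower bound of [g], [z] is within [e] of [k w]. *)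
pose g (z : R * R) := Num.max `|h z - w| (e - `|k w - z|).
have cg : continuous g.
  move=> z; suff : {for z, continuous g} by [].
  apply: cont_max.
    apply: (@continuous_comp _ _ _ (fun z : R * R => h z - w) (fun v : R * R => `|v|)).
      by apply: continuousB; [exact: (lift_continuous h_lift)|exact: cst_continuous].
    exact: norm_continuous.
  apply: continuousB; first exact: cst_continuous.
  apply: (@continuous_comp _ _ _ (fun z : R * R => k w - z) (fun v : R * R => `|v|)).
    by apply: continuousB; [exact: cst_continuous|exact: cont_id].
  exact: norm_continuous.
have [||m m0 mP] := @compact_pos_lbound R _ (box w.1 `*` box w.2) g _ cg.
- by apply: compact_setX; exact: segment_compact.
- move=> z _; rewrite /g lt_max; have [->|zw] := eqVneq z (k w).
    by rewrite subrr normr0 subr0 e0 orbT.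
  rewrite normr_gt0 subr_eq0; apply/orP; left; apply: contra zw => /eqP <-.
  by rewrite hK.
suff : nbhs (w : R * R) [set w' | `|k w - k w'| < e] by [].
apply/nbhs_ballP; exists (Num.min m 1); first by rewrite /= lt_min m0 ltr01.
move=> w'; rewrite -ball_normE /= lt_min => /andP[wm w1].
have : box w.1 (k w').1 /\ box w.2 (k w').2.
  have := hM (k w'); rewrite kK => d1; have := ltW w1; rewrite -normrN opprB => d2.
  have : `|k w' - w| <= M + 1.
    rewrite (_ : k w' - w = - (w' - k w') + (w' - w)); last by rewrite opprB addrA subrK.
    by rewrite (le_trans (ler_normD _ _))// normrN lerD.
  rewrite prod_normE ge_max /= !ler_norml => /andP[/andP[? ?] /andP[? ?]].
  by rewrite /box /= !in_itv/=; split; apply/andP; split; lra.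
move=> /(mP (k w')); rewrite /g kK le_max -normrN opprB => /orP[mw|me].
  by move: (lt_le_trans wm mw); rewrite ltxx.
lra.
Qed.

Lemma inverse_lift : plane_lift k.
Proof.
split; first exact: inverse_continuous.
- move=> z; apply: (can_inj hK); rewrite kK.
  by have := lift_shift h_lift (k z); rewrite kK => ->.
- move=> x y yl; have [x' e] := boundary_surj (or_introl (lexx 0)) x.
  rewrite -[in RHS]e hK /=.
  apply: (can_inj hK); rewrite kK (lift_low h_lift x' yl).
  by rewrite e.
- move=> x y yl; have [x' e] := boundary_surj (or_intror (lexx 1)) x.
  rewrite -[in RHS]e hK /=.
  apply: (can_inj hK); rewrite kK (lift_high h_lift x' yl).
  by rewrite e.
Qed.

Lemma inverse_area : area_invariant h -> area_invariant k.
Proof.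
have kl := inverse_lift; move=> ha U oU pU bU.
have V1 : open (k @^-1` U) by apply: (open_comp _ oU) => z _; exact: inverse_continuous.
have V2 : periodic_set (k @^-1` U).
  by move=> n z; rewrite /preimage /= (lift_shift_int n z kl); exact: pU.
have V3 z : (k @^-1` U) z -> 0 < z.2 < 1.
  move=> /bU /andP[z0 z1]; apply/andP; split; rewrite ltNge; apply/negP => zl.
    by move: z0; rewrite (lift_lowE kl zl)/= ltNge zl.
  by move: zl z1; case: z {z0} => x y /= yl; rewrite (lift_high kl x yl)/= ltNge yl.
rewrite -(ha _ V1 V2 V3); congr (_ _); congr (_ `&` _).
by apply/seteqP; split=> z; rewrite /preimage /= hK.
Qed.

End inverse.

(** * From the annulus to the plane *)

Section covering.
Variable R : realType.
Implicit Types z w : R * R.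

Lemma covering_map_eq z w :
  covering_map z = covering_map w <-> exists n : int, z = (w.1 + n%:~R, w.2).
Proof.
case: z => x y; case: w => x' y'; rewrite /covering_map /=; split.
  move=> [/eqP + <-];
    rewrite -(Quotient.idealrBE (GRing.ZmodClosed.clone R (@Num.int_num_subdef R) _)).
  move=> /intrP[n xn]; exists n; congr (_, _); lra.
move=> [n [-> ->]]; congr (_, _); apply/eqP.
rewrite -(Quotient.idealrBE (GRing.ZmodClosed.clone R (@Num.int_num_subdef R) _)).
by rewrite addrAC subrr add0r; apply/intrP; exists n.
Qed.

Lemma covering_map_surj (p : circle R * R) : exists z, covering_map z = p.
Proof. by case: p => c y; exists (repr c, y); rewrite /covering_map /= reprK. Qed.

End covering.

Section extension.
Variables (R : realType) (f : circle R * R -> circle R * R) (F : R * R -> R * R).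
Hypothesis F_lift : lift_of f F.
Hypothesis f_bd0 : f @` boundary_circle 0 `<=` boundary_circle 0.
Hypothesis f_bd1 : f @` boundary_circle 1 `<=` boundary_circle 1.
Hypothesis F_twist0 : forall x, (F (x, 0)).1 < x.
Hypothesis F_twist1 : forall x, x < (F (x, 1)).1.

(** The retraction of the line onto the unit interval; it extends a map of the strip to
    the plane. *)
Definition clamp (y : R) := Num.max 0 (Num.min 1 y).
Definition clamp2 (z : R * R) := (z.1, clamp z.2).

Lemma clamp_ge0le1 y : 0 <= clamp y <= 1.
Proof. by rewrite /clamp le_max lexx ge_max ler01 ge_min lexx. Qed.

Lemma clamp_id y : 0 <= y <= 1 -> clamp y = y.
Proof. by move=> /andP[y0 y1]; rewrite /clamp min_r// max_r. Qed.

Lemma clamp_low y : y <= 0 -> clamp y = 0.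
Proof. by move=> y0; rewrite /clamp max_l// ge_min y0 orbT. Qed.

Lemma clamp_high y : 1 <= y -> clamp y = 1.
Proof. by move=> y1; rewrite /clamp min_l// max_r. Qed.

Lemma clamp2_cover z : universal_cover (clamp2 z).
Proof. exact: clamp_ge0le1. Qed.

Lemma clamp2_id z : universal_cover z -> clamp2 z = z.
Proof. by case: z => x y zc; rewrite /clamp2 clamp_id. Qed.

Lemma clamp2_cont : continuous clamp2.
Proof.
move=> z; suff : {for z, continuous clamp2} by [].
apply: cont_pair; first exact: cvg_fst.
apply: cont_max; first exact: cst_continuous.
by apply: cont_min; [exact: cst_continuous|exact: cvg_snd].
Qed.

Lemma F_cover z : universal_cover z -> universal_cover (F z).
Proof. by case: F_lift => FS _ _; exact: FS. Qed.

Lemma F_map z : universal_cover z -> covering_map (F z) = f (covering_map z).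
Proof. by case: F_lift => _ _ Fm zc; apply: Fm; rewrite inE. Qed.

Lemma F_clamp_cont : continuous (F \o clamp2).
Proof.
case: F_lift => _ /subspace_continuousP Fc _ z.
have c1 : clamp2 w @[w --> z] --> within (@universal_cover R) (nbhs (clamp2 z)).
  move=> A; rewrite /within/= => /clamp2_cont; rewrite /= !near_simpl.
  by apply: filterS => s As; apply: As; exact: clamp2_cover.
have c2 : F w @[w --> within (@universal_cover R) (nbhs (clamp2 z))] --> F (clamp2 z).
  exact: Fc (clamp2_cover z).
have c3 : F (clamp2 w) @[w --> z] --> F (clamp2 z) by exact: (cvg_comp _ _ c1 c2).
exact: c3.
Qed.

Lemma F_bd0 x : (F (x, 0)).2 = 0.
Proof.
have zc : universal_cover (x, 0 : R) by rewrite /universal_cover /= lexx ler01.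
have : boundary_circle 0 (covering_map (F (x, 0))).
  by rewrite F_map//; apply: f_bd0; exists (covering_map (x, 0)).
by [].
Qed.

Lemma F_bd1 x : (F (x, 1)).2 = 1.
Proof.
have zc : universal_cover (x, 1 : R) by rewrite /universal_cover /= lexx ler01.
have : boundary_circle 1 (covering_map (F (x, 1))).
  by rewrite F_map//; apply: f_bd1; exists (covering_map (x, 1)).
by [].
Qed.

Definition extend z := ((F (clamp2 z)).1, (F (clamp2 z)).2 + (z.2 - clamp z.2)).

Lemma extendE z : universal_cover z -> extend z = F z.
Proof.
move=> zc; rewrite /extend clamp2_id// clamp_id// subrr addr0.
by case: (F z).
Qed.

Lemma extend_cont : continuous extend.
Proof.
move=> z; suff : {for z, continuous extend} by [].
apply: cont_pair; first by apply: (@cont_fst _ _ (F \o clamp2)); exact: F_clamp_cont.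
apply: continuousD; first by apply: (@cont_snd _ _ (F \o clamp2)); exact: F_clamp_cont.
apply: continuousB; first exact: cvg_snd.
by apply: (@cont_snd _ _ clamp2); exact: clamp2_cont.
Qed.

Lemma extend_low x y : y <= 0 -> extend (x, y) = ((extend (x, 0)).1, y).
Proof.
move=> y0; rewrite /extend /clamp2 /= !clamp_low// F_bd0.
by rewrite subr0 add0r.
Qed.

Lemma extend_high x y : 1 <= y -> extend (x, y) = ((extend (x, 1)).1, y).
Proof.
move=> y0; rewrite /extend /clamp2 /= !clamp_high// F_bd1.
by congr (_, _); lra.
Qed.

(** The translation defect of the lift is a continuous integer-valued function, hence a
    constant [d]. The twist condition on the bottom excludes [d > 1], as iterating would
    push far points to the right, and the one on the top excludes [d < 1]. *)
Lemma extend_shift z : extend (z.1 + 1, z.2) = ((extend z).1 + 1, (extend z).2).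
Proof.
pose s (z : R * R) := (z.1 + 1, z.2).
pose D z := (F (clamp2 (s z))).1 - (F (clamp2 z)).1.
have FS w : exists n : int, F (clamp2 (s w)) = ((F (clamp2 w)).1 + n%:~R, (F (clamp2 w)).2).
  apply/covering_map_eq; rewrite !F_map; [|exact: clamp2_cover..].
  congr (f _); apply/covering_map_eq; exists 1; rewrite mulr1z.
  by [].
have sc : continuous s.
  move=> w; suff : {for w, continuous s} by [].
  apply: cont_pair; last exact: cvg_snd.
  by apply: continuousD; [exact: cvg_fst|exact: cst_continuous].
have Dc : continuous D.
  move=> w; suff : {for w, continuous D} by [].
  apply: continuousB; last by apply: (@cont_fst _ _ (F \o clamp2)); exact: F_clamp_cont.
  apply: (@cont_fst _ _ (fun w => (F \o clamp2) (s w))).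
  by apply: (@continuous_comp _ _ _ s (F \o clamp2)); [exact: sc|exact: F_clamp_cont].
have Dconst w : D w = D (0, 0).
  (* The factor [2 pi] turns integrality into the vanishing of the angle. *)
  pose u (t : R) := pi *+ 2 * (D (seg (0, 0) w t) - D (0, 0)).
  have pi2 : pi *+ 2 != 0 :> R by rewrite mulrn_eq0/= gt_eqF// pi_gt0.
  have : u 1 = 0.
    apply: (@cos_eq1_const _ u 0 1 ler01).
    - apply: cont_within => t _; apply: continuousM; first exact: cst_continuous.
      apply: continuousB; last exact: cst_continuous.
      apply: (@continuous_comp _ _ _ (fun t => seg (0, 0) w t) D); last exact: Dc.
      by apply: cont_seg; [exact: cst_continuous|exact: cont_id].
    - move=> t _; rewrite /u /D; have [n ->] := FS (seg (0, 0) w t); have [m ->] := FS (0, 0).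
      have E (p n' q m' : R) : p + n' - p - (q + m' - q) = n' - m' by ring.
      rewrite /= E -intrB.
      by rewrite -[_ * _]add0r cos_periodic_int cos0.
    - by rewrite /u seg0 subrr mulr0.
  rewrite /u seg1 => /eqP; rewrite mulf_eq0 (negbTE pi2)/= subr_eq0 => /eqP //.
set d := D (0, 0) in Dconst.
have iterF y (m : nat) : 0 <= y <= 1 -> (F (m%:R, y)).1 = (F (0, y)).1 + m%:R * d.
  move=> y01; elim: m => [|m IH]; first by rewrite mul0r addr0.
  have := Dconst (m%:R, y); rewrite /D /s /clamp2 /= clamp_id// natr1 => /eqP.
  by rewrite subr_eq IH -natr1 => /eqP ->; ring.
have d1 : d = 1.
  have c0 : 0 <= (0 : R) <= 1 by rewrite lexx ler01.
  have c1 : 0 <= (1 : R) <= 1 by rewrite lexx ler01.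
  apply/eqP; rewrite eq_le; apply/andP; split; rewrite leNgt; apply/negP => dl.
    pose m := Num.bound (`|(F (0, 0)).1| / (d - 1)).
    have := F_twist0 m%:R; rewrite iterF//.
    have : `|(F (0, 0)).1| / (d - 1) < m%:R.
      by apply: archi_boundP; rewrite divr_ge0// subr_ge0 ltW.
    rewrite ltr_pdivrMr ?subr_gt0// ltr_norml => /andP[? ?] ?; lra.
  pose m := Num.bound (`|(F (0, 1)).1| / (1 - d)).
  have := F_twist1 m%:R; rewrite iterF//.
  have : `|(F (0, 1)).1| / (1 - d) < m%:R.
    by apply: archi_boundP; rewrite divr_ge0// subr_ge0 ltW.
  rewrite ltr_pdivrMr ?subr_gt0// ltr_norml => /andP[? ?] ?; lra.
have [n sz] := FS z; have := Dconst z; rewrite /D d1 => /eqP.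
rewrite subr_eq addrC => /eqP e1.
rewrite /extend -[clamp2 (_, _)]/(clamp2 (s z)) e1 /=; congr (_, _).
by rewrite sz.
Qed.

Lemma extend_lift : plane_lift extend.
Proof. by split; [exact: extend_cont|exact: extend_shift|exact: extend_low|exact: extend_high]. Qed.

Lemma F_shift_int (n : int) z : universal_cover z ->
  F (z.1 + n%:~R, z.2) = ((F z).1 + n%:~R, (F z).2).
Proof.
by move=> zc; rewrite -!extendE//; exact: (lift_shift_int n z extend_lift).
Qed.

Lemma extend_twist0 x : (extend (x, 0)).1 < x.
Proof. by rewrite extendE// /universal_cover /= lexx ler01. Qed.

Lemma extend_twist1 x : x < (extend (x, 1)).1.
Proof. by rewrite extendE// /universal_cover /= lexx ler01. Qed.

Variable g : circle R * R -> circle R * R.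
Hypothesis g_annulus : set_fun (@annulus R) (@annulus R) g.
Hypothesis fgK : {in @annulus R, cancel f g}.
Hypothesis gfK : {in @annulus R, cancel g f}.

Lemma F_inj z w : universal_cover z -> universal_cover w -> F z = F w -> z = w.
Proof.
move=> zc wc e; have : covering_map z = covering_map w.
  rewrite -[LHS]fgK ?inE// -[RHS]fgK ?inE//.
  by rewrite -!F_map// e.
move=> /covering_map_eq[n zE]; move: e; rewrite zE F_shift_int//.
case: (F w) => a b /= [] /eqP; rewrite -subr_eq0 addrAC subrr add0r => /eqP ->.
by rewrite addr0; case: (w).
Qed.

Lemma F_surj w : universal_cover w -> exists2 z, universal_cover z & F z = w.
Proof.
move=> wc; have aw : annulus (covering_map w) by [].
have [z zE] := covering_map_surj (g (covering_map w)).
have zc : universal_cover z.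
  by have : annulus (covering_map z) by rewrite zE; exact: g_annulus.
have : covering_map (F z) = covering_map w by rewrite F_map// zE gfK// inE.
move=> /covering_map_eq[n FE]; exists (z.1 + (- n)%:~R, z.2); first exact: zc.
by rewrite F_shift_int// FE mulrNz /= addrK; case: (w).
Qed.

Lemma clamp2_extend z : clamp2 (extend z) = F (clamp2 z) /\
  (extend z).2 - clamp (extend z).2 = z.2 - clamp z.2.
Proof.
have [yl|yl] := leP z.2 0.
  case: z yl => x y yl; rewrite (extend_low x yl) extendE; last first.
    by rewrite /universal_cover /= lexx ler01.
  rewrite /clamp2 /= (clamp_low yl); split=> //.
  by have := F_bd0 x; case: (F _) => a b /= ->.
have [yh|yh] := leP 1 z.2.
  case: z yl yh => x y yl yh; rewrite (extend_high x yh) extendE; last first.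
    by rewrite /universal_cover /= lexx ler01.
  rewrite /clamp2 /= (clamp_high yh); split=> //.
  by have := F_bd1 x; case: (F _) => a b /= ->.
have zc : universal_cover z by rewrite /universal_cover /= !ltW.
by rewrite extendE// !clamp2_id//; [rewrite !clamp_id ?subrr//; exact: F_cover|exact: F_cover].
Qed.

Lemma extend_inj : injective extend.
Proof.
move=> z w e; have [z1 z2] := clamp2_extend z; have [w1 w2] := clamp2_extend w.
have cE : clamp2 z = clamp2 w.
  by apply: F_inj; [exact: clamp2_cover|exact: clamp2_cover|rewrite -z1 -w1 e].
move: z2; rewrite e w2; move: cE; rewrite /clamp2 => -[e1 ->] /addIr e2.
by move: e1 e2; case: z {e z1}; case: w {w1 w2} => ? ? ? ? /= -> ->.
Qed.

Lemma extend_surj w : exists z, extend z = w.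
Proof.
case: w => x y.
have [yl|yl] := leP y 0;
  first by have [x' e] := boundary_surj extend_lift (or_introl yl) x; exists (x', y).
have [yh|yh] := leP 1 y;
  first by have [x' e] := boundary_surj extend_lift (or_intror yh) x; exists (x', y).
have wc : universal_cover (x, y) by rewrite /universal_cover /= !ltW.
by have [z zc e] := F_surj wc; exists z; rewrite extendE.
Qed.

(** An open periodic set is the full preimage of its projection, to which the
    preservation of area on the annulus applies. *)
Lemma extend_area : area_preserving f -> area_invariant extend.
Proof.
move=> fa U oU pU bU.
have cU : @covering_map R @^-1` (@covering_map R @` U) = U.
  apply/seteqP; split=> z; last by exists z.
  by move=> [w Uw /esym/covering_map_eq[n ->]]; exact/(pU n w).
have mB : annulus_measurable (@covering_map R @` U).
  split; last by rewrite cU; exact: open_measurable2.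
  by move=> _ [z /bU /andP[z0 z1] <-]; rewrite /annulus /= !ltW.
have [_] := fa _ mB; rewrite /area cU => <-.
congr (_ _); apply/seteqP; split=> z [zsq].
  move=> Uz; split=> //; have zc : universal_cover z by case: zsq => _; rewrite /= in_itv.
  split=> //; rewrite /preimage /= -F_map//; exists (F z) => //.
  by rewrite -extendE.
move=> [zc [w Uw]]; rewrite -F_map// => /esym/covering_map_eq[n Fz].
by split=> //; rewrite /preimage /= extendE// Fz; exact/(pU n w).
Qed.

End extension.

Theorem corollary2p2 (R : realType) (f : circle R * R -> circle R * R)
  (f_diffeo : C1_annulus_diffeo f)
  (f_bd0 : f @` boundary_circle 0 `<=` boundary_circle 0)
  (f_bd1 : f @` boundary_circle 1 `<=` boundary_circle 1)
  (f_area : area_preserving f)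
  (f_twist : twist_map f) :
  exists p q : circle R * R,
    [/\ annulus p, annulus q, p <> q, f p = p & f q = q].
Proof.
have [F [Fl t0 t1]] := f_twist.
have [_ [g [[gA _] fgK gfK]]] := f_diffeo.
set h := extend F.
have hl : plane_lift h := extend_lift Fl f_bd0 f_bd1 t0 t1.
have ht0 : forall x, (h (x, 0)).1 < x := extend_twist0 t0.
have ht1 : forall x, x < (h (x, 1)).1 := extend_twist1 t1.
have [k kK] := choice (extend_surj Fl f_bd0 f_bd1 t0 t1 gA gfK).
have hK : cancel h k.
  by move=> z; apply: (extend_inj Fl f_bd0 f_bd1 t0 t1 fgK); rewrite kK.
have kl := inverse_lift hl hK kK.
have ha : area_invariant h := extend_area Fl f_area.
have ka := inverse_area hl hK kK ha.
apply: contrapT => none.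
have fixed z : h z = z -> universal_cover z /\ f (covering_map z) = covering_map z.
  move=> e; have zc : universal_cover z.
    apply/andP; split; rewrite leNgt; apply/negP => zl.
      exact: (nonfixed_low hl ht0 (ltW zl)).
    exact: (nonfixed_high hl ht1 (ltW zl)).
  by split=> //; rewrite -(F_map Fl)// -extendE// -/h e.
have [x0 [y0 hfix]] : exists x0 y0 : R, forall z, h z = z ->
    z.2 = y0 /\ exists n : int, z.1 = x0 + n%:~R.
  have [[w hw]|nofix] := pselect (exists w, h w = w); last first.
    by exists 0, 0 => z hz; exfalso; apply: nofix; exists z.
  exists w.1, w.2 => z hz; have [zc fz] := fixed z hz; have [wc fw] := fixed w hw.
  have : covering_map z = covering_map w.
    apply: contrapT => zw; apply: none.
    by exists (covering_map z), (covering_map w); split.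
  by move=> /covering_map_eq[n ->]; split=> //; exists n.
apply: (no_double_escape hl kl hK kK ht0 ht1 hfix) => e e0.
  exact: (escape_exists x0 hl kl hK kK e0 ha).
exact: (escape_exists x0 kl hl kK hK e0 ka).
Qed.
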